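(* Assume $-y\ge r/(4c)$ and that $h$ is Lipschitz continuous on $[0,D]$. Let $x\in[0,\beta_0]$, and suppose that the minimizer uses the $\beta_0$-barrier strategy $\bar\alpha_{\beta_0}$ of the hitting time game. Let $\delta$ be a constant chosen as follows: $\delta=0$ if $y^2-h(\beta_0)/c>0$ or $x<\beta_0$; and $0<\delta\le x$ if $y^2-h(\beta_0)/c=0$ and $x=\beta_0$. Let $$\tilde\tau=\delta+\int_0^{x+y\delta}\frac{1}{\sqrt{y^2-h(\xi)/c}}\,d\xi,$$ let $\omega:[0,\tilde\tau]\to\mathbb{R}$ be the function, continuous on $[0,\tilde\tau]$ with $\omega(0)=0$ and $C^1$ on $[\delta,\tilde\tau]$, that equals $0$ on $[0,\delta]$ and on $[\delta,\tilde\tau]$ is the unique solution of $$\dot\omega(t)=-y-\sqrt{y^2-h\big((x+yt+\omega(t))\wedge(x+y\delta)\big)/c},\qquad t\in[\delta,\tilde\tau],$$ and let $$\psi(t)=\Big(\frac{c}{c_1}\omega(t),\,-\frac{c}{c_2}\omega(t)\Big),\qquad t\in[0,\tilde\tau].$$ Then: 1. If $y^2-h(\beta_0)/c>0$ or $x<\beta_0$, then $\bar c(x,\psi,\bar\alpha_{\beta_0}[\psi])=U(x)$. 2. If $y^2-h(\beta_0)/c=0$ and $x=\beta_0$, then there is a positive constant $C$ such that for every $0<\delta\le x$ one has $|\bar c(x,\psi,\bar\alpha_{\beta_0}[\psi])-U(x)|\le C\delta$. 3. Moreover, for every $\delta\ge0$ (with $\delta$ as chosen above), the termination time of the game, $\tau=\tau(x,\psi,\bar\alpha_{\beta_0}[\psi])$,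 is $\tau=\tilde\tau$.
   Context: Fixed data: constants $D>0$, $r>0$, $c_1>0$, $c_2>0$, $y\in\mathbb{R}$; $c:=(c_1^{-1}+c_2^{-1})^{-1}$; and a continuous, strictly increasing function $h:[0,D]\to[0,\infty)$ with $h(0)=0$. Under $-y\ge r/(4c)$ define $$\beta_0=\begin{cases}h^{-1}\big(-\tfrac{r^2}{4c}-ry\big), & -h(D)\le \tfrac{r^2}{4c}+ry\le -h(0)=0,\\ D, & \tfrac{r^2}{4c}+ry<-h(D).\end{cases}$$ (One has $y^2-h(u)/c\ge0$ for $u\in[0,\beta_0]$.) Let $\mathcal{P}$ be the set of continuous functions $[0,\infty)\to\mathbb{R}$ starting at $0$, and $\mathcal{E}$ the set of nondecreasing right-continuous functions with left limits $[0,\infty)\to[0,\infty)$ (a positive value at time $0$ is allowed and is regarded as a jump at time $0$). For $T\ge0$ and $\psi=(\psi^1,\psi^2)\in\mathcal{P}^2$ let $\mathbb{I}(T,\psi)=\int_0^T\big[c_1(\dot\psi^1(s))^2+c_2(\dot\psi^2(s))^2\big]ds$ if $\psi^1,\psi^2$ are absolutely continuous on $[0,T]$, and $\mathbb{I}(T,\psi)=+\infty$ otherwise. Hitting time game. Given $x\in[0,D]$, $\psi\in\mathcal{P}^2$ (chosen by the maximizer), $\varrho\in\mathcal{E}$ (chosen by the minimizer), the dynamics are $\varphi_{x,\psi,\varrho}(t)=x+yt+\psi^1(t)-\psi^2(t)-\varrho(t)$, $t\ge0$, and $\tau(x,\psi,\varrho)=\inf\{t\ge0:\varphi_{x,\psi,\varrho}(t)=0\}$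 ($\inf\emptyset=\infty$). The game terminates at $\tau$. A strategy (for the minimizer) is a map $\bar\alpha:\mathcal{P}^2\to\mathcal{E}$ that is causal: for every $t\ge0$, if $\psi=\tilde\psi$ on $[0,t]$ then $\bar\alpha[\psi]=\bar\alpha[\tilde\psi]$ on $[0,t]$. A strategy is admissible if for every $t\ge0$ the dynamics satisfies $\varphi(t)\in[0,D]$; $\bar{\mathcal{A}}_x$ denotes the set of all admissible strategies for initial state $x$. Let $\mathcal{Q}[x,\bar\alpha]=\{\psi\in\mathcal{P}^2:\tau(x,\psi,\bar\alpha[\psi])<\infty\}$. For $\psi\in\mathcal{Q}[x,\bar\alpha]$ set, with $\tau=\tau(x,\psi,\bar\alpha[\psi])$ and $\varphi=\varphi_{x,\psi,\bar\alpha[\psi]}$, $$\bar c(x,\psi,\bar\alpha[\psi])=\int_0^\tau h(\varphi(t))\,dt+r\,\bar\alpha[\psi](\tau)-\mathbb{I}(\tau,\psi),\qquad U(x)=\inf_{\bar\alpha\in\bar{\mathcal{A}}_x}\ \sup_{\psi\in\mathcal{Q}[x,\bar\alpha]}\bar c(x,\psi,\bar\alpha[\psi]).$$ The cost depends on $\psi$ only through its values up to $\tau$; the path $\psi$ of the claim is specified on $[0,\tilde\tau]$ only. Skorohod map. For $a<b$, $\Gamma_{[a,b]}$ maps a right-continuous path with left limits $w:[0,\infty)\to\mathbb{R}$ to the unique triplet $(\varphi,\eta_1,\eta_2)$ such that $\varphi=w+\eta_1-\eta_2$, $\varphi(t)\in[a,b]$ for all $t$, $\eta_1,\eta_2$ are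 nonnegative and nondecreasing with $\eta_i(0-)=0$ (a positive value $\eta_i(0)$ is regarded as a jump at $0$), and $\int_{[0,\infty)}1_{(a,b]}(\varphi)\,d\eta_1=\int_{[0,\infty)}1_{[a,b)}(\varphi)\,d\eta_2=0$. Barrier strategy. For $(x,\beta)\in[0,D]^2$, a strategy $\bar\alpha_\beta\in\bar{\mathcal{A}}_x$ is called a $\beta$-barrier strategy if for every $\psi\in\mathcal{Q}[x,\bar\alpha_\beta]$ one has $(\varphi,0,\bar\alpha_\beta[\psi])=\Gamma_{[0,\beta]}(x+y\cdot+\psi^1-\psi^2)$ on the time interval $[0,\tau]$, where $\varphi$ is the corresponding dynamics. (In the degenerate case $\beta=0$, this means $\bar\alpha_0[\psi](0)=x$, so that $\tau=0$.)
   Formalization: Admissibility asks that φ(t) lie in [0,D] only up to the termination time τ (if asked for all t≥0, no strategy is admissible); for δ with x+yδ<0, where h is undefined, h is extended by 0 to negative arguments and the integral in τ̃ is taken as oriented. *)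

(* Defs.v *)
From HB Require Import structures.
From mathcomp Require Import all_boot all_order all_algebra.
From mathcomp Require Import all_classical all_reals all_analysis.

Set Implicit Arguments.
Unset Strict Implicit.
Unset Printing Implicit Defensive.

Import Order.TTheory GRing.Theory Num.Theory.
Import numFieldNormedType.Exports.

Local Open Scope classical_set_scope.
Local Open Scope ring_scope.

(* Time is [0, +oo[ and h lives on [0, D]; both kinds of functions are encoded
   as total functions R -> R, of which only the values on these sets matter. *)

Section Paths.
Context {R : realType}.

Definition path2 : Type := ((R -> R) * (R -> R))%type.

Definition continuous_path (f : R -> R) : Prop :=
  {within `[0, +oo[, continuous f} /\ f 0 = 0.

Definition continuous_path2 (psi : path2) : Prop :=
  continuous_path psi.1 /\ continuous_path psi.2.

Definition cadlag (f : R -> R) : Prop :=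
  (forall t, 0 <= t -> f @ t^'+ --> f t) /\
  (forall t, 0 < t -> cvg (f @ t^'-)).

Definition control_path (rho : R -> R) : Prop :=
  [/\ forall t, 0 <= t -> 0 <= rho t,
      forall s t, 0 <= s -> s <= t -> rho s <= rho t
    & cadlag rho].

Definition abs_continuous (a b : R) (f : R -> R) : Prop :=
  forall e : R, 0 < e -> exists d : R, 0 < d /\
  forall (n : nat) (u v : 'I_n -> R),
    (forall i, [/\ a <= u i, u i <= v i & v i <= b]) ->
    trivIset setT (fun i => `]u i, v i[%classic) ->
    \sum_(i < n) (v i - u i) < d ->
    \sum_(i < n) `|f (v i) - f (u i)| < e.

(* The derivatives exist almost everywhere on [0, T] when both components are
   absolutely continuous; elsewhere derive1 takes an irrelevant default value. *)
Definition path_cost (c1 c2 T : R) (psi : path2) : \bar R :=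
  if `[< abs_continuous 0 T psi.1 /\ abs_continuous 0 T psi.2 >]
  then (\int[lebesgue_measure]_(s in `[0%R, T])
          (c1 * (derive1 psi.1 s) ^+ 2 + c2 * (derive1 psi.2 s) ^+ 2)%:E)%E
  else +oo%E.

Definition has_derivative_within (A : set R) (f : R -> R) (t l : R) : Prop :=
  (fun s => (s - t)^-1 * (f s - f t)) @ within A t^' --> l.

(* int_0^b f, with the usual sign convention when b < 0 *)
Definition oriented_integral (f : R -> R) (b : R) : R :=
  if 0 <= b then \int[lebesgue_measure]_(xi in `[0, b]) f xi
  else - \int[lebesgue_measure]_(xi in `[b, 0]) f xi.

End Paths.
Arguments path2 R : clear implicits.

Section Skorohod.
Context {R : realType}.

(* (phi, eta1, eta2) is the image of w under Gamma_[a, b].  As cumulative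
   functions on the whole line that vanish on the negative half-line
   (eta_i(0-) = 0), eta1 and eta2 are nonnegative, and their Stieltjes measures
   charge {0} with mass eta_i(0). *)
Definition is_skorohod (a b : R) (w phi : R -> R)
    (eta1 eta2 : cumulative R R) : Prop :=
  [/\ forall t, t < 0 -> eta1 t = 0 /\ eta2 t = 0,
      forall t, 0 <= t -> phi t = w t + eta1 t - eta2 t,
      forall t, 0 <= t -> phi t \in `[a, b],
      (\int[lebesgue_stieltjes_measure eta1]_(t in `[0%R, +oo[)
         (\1_`]a, b] (phi t))%:E = 0)%E
    & (\int[lebesgue_stieltjes_measure eta2]_(t in `[0%R, +oo[)
         (\1_`[a, b[ (phi t))%:E = 0)%E].

End Skorohod.

Section Game.
Context {R : realType}.
Variables (D r c1 c2 y : R) (h : R -> R).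

Definition ceff : R := (c1^-1 + c2^-1)^-1.

Definition hinv (v : R) : R := xget 0 [set u | u \in `[0, D] /\ h u = v].

(* For r / (4 * ceff) <= - y the quantity r ^+ 2 / (4 * ceff) + r * y is
   nonpositive, so the two branches are the two cases of beta_0. *)
Definition beta0 : R :=
  if - h D <= r ^+ 2 / (4 * ceff) + r * y
  then hinv (- (r ^+ 2 / (4 * ceff)) - r * y) else D.

Definition dynamics (x : R) (psi : path2 R) (rho : R -> R) : R -> R :=
  fun t => x + y * t + psi.1 t - psi.2 t - rho t.

Definition hitting_time (x : R) (psi : path2 R) (rho : R -> R) : \bar R :=
  ereal_inf [set t%:E | t in [set t : R | 0 <= t /\ dynamics x psi rho t = 0]].

Definition strategy : Type := path2 R -> R -> R.

Definition is_strategy (alpha : strategy) : Prop :=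
  (forall psi, continuous_path2 psi -> control_path (alpha psi)) /\
  (forall t psi psi', 0 <= t -> continuous_path2 psi -> continuous_path2 psi' ->
    (forall s, s \in `[0, t] -> psi.1 s = psi'.1 s /\ psi.2 s = psi'.2 s) ->
    forall s, s \in `[0, t] -> alpha psi s = alpha psi' s).

(* The game terminates at the hitting time, so the state constraint bears on
   the times up to it.  (Beyond it, the constraint could not be met: the
   control can only decrease the state.) *)
Definition admissible (x : R) : set strategy :=
  [set alpha | is_strategy alpha /\
    forall psi, continuous_path2 psi ->
    forall t : R, 0 <= t -> (t%:E <= hitting_time x psi (alpha psi))%E ->
      dynamics x psi (alpha psi) t \in `[0, D]].

Definition terminating (x : R) (alpha : strategy) : set (path2 R) :=
  [set psi | continuous_path2 psi /\
    (hitting_time x psi (alpha psi) < +oo)%E].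

(* meaningful when hitting_time x psi rho is finite *)
Definition cost (x : R) (psi : path2 R) (rho : R -> R) : \bar R :=
  let tau := fine (hitting_time x psi rho) in
  (\int[lebesgue_measure]_(t in `[0%R, tau]) (h (dynamics x psi rho t))%:E
   + (r * rho tau)%:E - path_cost c1 c2 tau psi)%E.

Definition value (x : R) : \bar R :=
  ereal_inf [set ereal_sup [set cost x psi (alpha psi)
                           | psi in terminating x alpha]
            | alpha in admissible x].

Definition barrier_strategy (x beta : R) (alpha : strategy) : Prop :=
  [/\ x \in `[0, D], beta \in `[0, D], admissible x alpha
    & forall psi, terminating x alpha psi ->
        if beta == 0 then alpha psi 0 = x
        else exists (phi : R -> R) (eta1 eta2 : cumulative R R),
          is_skorohod 0 beta (fun t => x + y * t + psi.1 t - psi.2 t)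
            phi eta1 eta2 /\
          forall t : R, 0 <= t ->
            (t%:E <= hitting_time x psi (alpha psi))%E ->
            [/\ dynamics x psi (alpha psi) t = phi t, eta1 t = 0
              & alpha psi t = eta2 t]].

(* h extended to the negative half-line by h 0.  The extension plays a role
   only when x + y * delta < 0; then tau_tilde = x / (- y) < delta. *)
Definition hext (u : R) : R := h (Num.max 0 u).

Definition tau_tilde (x delta : R) : R :=
  delta + oriented_integral (fun xi => (Num.sqrt (y ^+ 2 - hext xi / ceff))^-1)
                    (x + y * delta).

Definition is_omega (x delta : R) (omega : R -> R) : Prop :=
  let I := `[delta, tau_tilde x delta]%classic in
  [/\ {within `[0, tau_tilde x delta], continuous omega},
      omega 0 = 0,
      forall t, t \in `[0, delta] -> t <= tau_tilde x delta -> omega t = 0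
    & exists domega : R -> R, {within I, continuous domega} /\
        forall t, I t ->
          has_derivative_within I omega t (domega t) /\
          domega t = - y - Num.sqrt (y ^+ 2 -
            hext (Num.min (x + y * t + omega t) (x + y * delta)) / ceff)].

(* psi is an arbitrary continuation beyond tau_tilde of the claimed path *)
Definition claimed_path (x delta : R) (psi : path2 R) : Prop :=
  continuous_path2 psi /\
  exists omega, is_omega x delta omega /\
    forall t, t \in `[0, tau_tilde x delta] ->
      psi.1 t = ceff / c1 * omega t /\ psi.2 t = - (ceff / c2) * omega t.

End Game.
Arguments strategy R : clear implicits.

(* Main.v *)
Require Import Defs.
From HB Require Import structures.
From mathcomp Require Import all_boot all_order all_algebra.
From mathcomp Require Import all_classical all_reals all_analysis.
From mathcomp Require Import measurable_realfun ring lra.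

Set Implicit Arguments.
Unset Strict Implicit.
Unset Printing Implicit Defensive.

Import Order.TTheory GRing.Theory Num.Theory.
Import numFieldNormedType.Exports.

Local Open Scope classical_set_scope.
Local Open Scope ring_scope.

(* Write v for the net velocity of the path chosen by the maximizer; producing it costs
   at least c * v ^+ 2 per unit of time.  On [0, beta0] the value function V solves
   V' * y + V' ^+ 2 / (4 * c) + h = 0 with V 0 = 0 and V' <= r, that is V' = 2 * c * f
   with f = - y - sqrt (y ^+ 2 - h / c); in particular V is convex.  Against the barrier
   strategy, the equation gives cost <= V x away from the barrier, while staying at the
   barrier never pays since h beta0 + r * y + r ^+ 2 / (4 * c) <= 0.  Against any
   admissible strategy, the feedback v = f (state) secures V x because pushing costs
   r >= V' per unit.  The explicit path follows this feedback and moves strictly below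
   the barrier, which therefore stays idle; its cost is V x up to what happens on the
   initial time interval of length delta. *)

(** * Absolutely continuous functions *)

(** Minimizing [c1 * a ^+ 2 + c2 * b ^+ 2] under [a - b = v] gives [c * v ^+ 2], the origin of
    [ceff]. Holding the state at a barrier [u] with net velocity [v] yields
    [h u + r * (y + v) - c * v ^+ 2] per unit of time. This never exceeds
    [h u + r * y + r ^+ 2 / (4 * c)], its value at [v = r / (2 * c)], and [beta0] is the largest
    barrier in [[0, D]] for which that bound is nonpositive. The rate [f] maximizes
    [V' * v - c * v ^+ 2]. In the degenerate case [y + f] vanishes at [beta0]: the feedback path
    would rest there, so it first drifts below for a time [delta]. The obstacle is that paths are
    merely absolutely continuous, controls may jump, and the energy integrates pointwise
    derivatives, so no chain rule applies to [V] of the state. The energy of an arbitrary path is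
    therefore used only through a function [E] of time whose increments dominate linear functionals
    of the path ([path_cost_minorant]), and [V] through tangent inequalities. Building [E] takes the
    fundamental theorem of calculus for absolutely continuous functions. *)

Section AbsoluteContinuity.
Context {R : realType}.
Implicit Types (a b t : R) (f g : R -> R).

Lemma abs_continuous_fin a b f : abs_continuous a b f ->
  forall e : R, 0 < e -> exists d : R, 0 < d /\
  forall (J : finType) (u v : J -> R),
    (forall i, [/\ a <= u i, u i <= v i & v i <= b]) ->
    trivIset setT (fun i => `]u i, v i[%classic) ->
    \sum_i (v i - u i) < d -> \sum_i `|f (v i) - f (u i)| < e.
Proof.
move=> acf e e0; have [d [d0 H]] := acf e e0; exists d; split => // J u v uv tuv.
have E (F : J -> R) : \sum_i F i = \sum_(k < #|predT : pred J|) F (enum_val k).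
  by rewrite -(big_enum_val (A := predT)).
rewrite !E => sd; apply: (H _ (u \o enum_val) (v \o enum_val)) => //.
  by move=> i; exact: uv.
by move=> i j _ _ /(tuv _ _ I I) /enum_val_inj.
Qed.

(** Used with [X i] the variations over the partitions of the [i]-th interval: a bound for all
    simultaneous choices passes to the sum of the suprema. In the induction, fixing one element of
    [X ord0] bounds the other suprema, and nonemptiness makes their sum finite, hence
    subtractable. *)
Lemma sum_ereal_sup_le n (X : 'I_n -> set R) (e : R) :
  (forall i, X i !=set0) ->
  (forall x : 'I_n -> R, (forall i, X i (x i)) -> \sum_i x i <= e) ->
  (\sum_i ereal_sup (EFin @` X i) <= e%:E)%E.
Proof.
elim: n X e => [|n IH] X e X0 H.
  rewrite big_ord0 lee_fin; have := H (fun i => 0).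
  by rewrite big_ord0; apply => -[].
rewrite big_ord_recl.
have IHx x0 : X ord0 x0 ->
    (\sum_i ereal_sup (EFin @` X (lift ord0 i)) <= (e - x0)%:E)%E.
  move=> Xx0; apply: IH => // x Xx.
  have := H (fun i => if unlift ord0 i is Some j then x j else x0).
  rewrite big_ord_recl unlift_none => H1.
  rewrite lerBrDl; apply: le_trans (H1 _) => [|i].
    by rewrite lerD2l; apply: ler_sum => i _; rewrite liftK.
  by case: unliftP => [j ->|->].
have [x0 Xx0] := X0 ord0.
have {X0}[y Xy] : exists y : 'I_n.+1 -> R, forall i, X i (y i).
  by have [y Xy] := choice X0; exists y.
set S := (\sum_i _)%E in IHx *.
have : S \is a fin_num.
  rewrite fin_numElt (le_lt_trans (IHx _ Xx0)) ?ltry// andbT.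
  apply: (@lt_le_trans _ _ (\sum_(i < n) (y (lift ord0 i))%:E)%E).
    by rewrite sumEFin ltNyr.
  by apply: lee_sum => i _; apply: ereal_sup_ubound; exists (y (lift ord0 i)).
move: S IHx => [s| |]// IHx _.
rewrite -leeBrDr//; apply: ge_ereal_sup => _ [x Xx <-].
by have := IHx _ Xx; rewrite -EFinB !lee_fin; lra.
Qed.

(** Partitions of the disjoint intervals together form one disjoint family of the same total length,
    so absolute continuity applies to all their cells at once. The cells are indexed by dependent
    pairs, which is why [abs_continuous_fin] allows any finite index type. *)
Lemma abs_continuous_total_variation_sum a b f : abs_continuous a b f ->
  forall e : R, 0 < e -> exists d : R, 0 < d /\
  forall n (u v : 'I_n -> R),
    (forall i, [/\ a <= u i, u i <= v i & v i <= b]) ->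
    trivIset setT (fun i => `]u i, v i[%classic) ->
    \sum_i (v i - u i) < d ->
    (\sum_i total_variation (u i) (v i) f <= e%:E)%E.
Proof.
move=> acf e e0; have [d [d0 H]] := abs_continuous_fin acf e0.
exists d; split => // n u v uv tuv sd; apply: sum_ereal_sup_le => [i|x Xx].
  have [_ + _] := uv i; rewrite le_eqVlt => /predU1P[->|uvi].
    by rewrite variationsxx; exists 0.
  exact: variations_neq0.
have /choice[s sx] : forall i, exists s,
    itv_partition (u i) (v i) s /\ variation (u i) (v i) f s = x i.
  by move=> i; have [s ? ?] := Xx i; exists s.
pose w i k := nth (v i) (u i :: s i) k.
have E (F : R -> R -> R) : \sum_(i < n) \sum_(0 <= k < size (s i)) F (w i k) (w i k.+1)
   = \sum_(p : {i : 'I_n & 'I_(size (s i))}) F (w (tag p) (tagged p)) (w (tag p) (tagged p).+1).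
  under eq_bigr do rewrite big_mkord.
  by rewrite (sig_big_dep xpredT (fun i j => true)
     (fun i (j : 'I_(size (s i))) => F (w i j) (w i j.+1))).
have ssz i (k : nat) : (k < size (s i))%N -> w i k < w i k.+1.
  have [[/= pth _] _] := sx i.
  by move=> ki; rewrite lt_sorted_ltn_nth ?inE//= ltnS// ltnW.
have wle i j k : (j <= k <= size (s i))%N -> w i j <= w i k.
  have [[/= pth _] _] := sx i => /andP[jk ks].
  rewrite le_sorted_leq_nth ?inE//= ?ltnS//.
    by apply: sub_path pth => ? ?; exact: ltW.
  exact: leq_trans jk ks.
have w0 i : w i 0%N = u i by [].
have wn i : w i (size (s i)) = v i by apply: itv_partition_nth_size; exact: (sx i).1.
have -> : \sum_i x i = \sum_i \sum_(0 <= k < size (s i)) `|f (w i k.+1) - f (w i k)|.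
  by apply: eq_bigr => i _; rewrite -(sx i).2.
rewrite (E (fun p q => `|f q - f p|)); apply/ltW/H => [[i k]|[i j] [k l] _ _|] /=.
- have ki := ltn_ord k; have [au _ vb] := uv i.
  split; first by rewrite (le_trans au)// -w0 wle//= ltnW.
    exact/ltW/ssz.
  by rewrite (le_trans _ vb)// -wn wle// ki leqnn.
- move=> [p [/=]]; rewrite !in_itv /= => /andP[p1 p2] /andP[p3 p4].
  have ik : i = k.
    have wuv i0 j0 : (j0 <= size (s i0))%N -> u i0 <= w i0 j0 <= v i0.
      by move=> j0s; rewrite -{1}(w0 i0) -(wn i0) !wle// ?j0s ?leqnn.
    have /andP[? _] := wuv i j (ltnW (ltn_ord j)).
    have /andP[_ ?] := wuv i j.+1 (ltn_ord j).
    have /andP[? _] := wuv k l (ltnW (ltn_ord l)).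
    have /andP[_ ?] := wuv k l.+1 (ltn_ord l).
    apply: (tuv i k) => //; exists p; split; rewrite /= in_itv/=; apply/andP; split.
    + exact: le_lt_trans p1.
    + exact: lt_le_trans p2 _.
    + exact: le_lt_trans p3.
    + exact: lt_le_trans p4 _.
  subst k; congr existT; apply/val_inj => /=.
  have [jl|jl|//] := ltngtP j l.
    have h : w i j.+1 <= w i l by rewrite wle// jl ltnW.
    by have := lt_trans (lt_le_trans p2 h) p3; rewrite ltxx.
  have h : w i l.+1 <= w i j by rewrite wle// jl ltnW.
  by have := lt_trans (lt_le_trans p4 h) p1; rewrite ltxx.
- rewrite -(E (fun p q => q - p)); apply: le_lt_trans sd; apply: ler_sum => i _.
  by rewrite telescope_sumr// w0 wn.
Qed.

(** With tolerance [1], an interval shorter than [d] has variation at most [1]; finitely many steps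
    of length [d / 2] cover [[a, t]]. *)
Lemma abs_continuous_total_variation_fin a b f : a <= b -> abs_continuous a b f ->
  forall t, a <= t <= b -> total_variation a t f \is a fin_num.
Proof.
move=> ab acf.
have [d [d0 H]] := abs_continuous_total_variation_sum acf (@ltr01 R).
have small u v : a <= u -> u <= v -> v <= b -> v - u < d ->
    total_variation u v f \is a fin_num.
  move=> au uv vb uvd; rewrite ge0_fin_numE ?total_variation_ge0//.
  have := H 1%N (fun=> u) (fun=> v); rewrite !big_ord1 => /(_ _ _ uvd) tv.
  apply: (@le_lt_trans _ _ 1%:E); last exact: ltry.
  by apply: tv => [//|i j _ _ _]; rewrite (ord1 i) (ord1 j).
have step n t : a <= t <= b -> t - a <= n%:R * (d / 2) ->
  total_variation a t f \is a fin_num.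
  elim: n t => [|n IH] t /andP[at_ tb] tn.
    have -> : t = a by lra.
    by rewrite total_variationxx.
  pose u := Num.max a (t - d / 2).
  have au : a <= u by rewrite le_max lexx.
  have ut : u <= t by rewrite ge_max at_ lerBlDr lerDl; lra.
  have utd : t - u <= d / 2.
    have : t - d / 2 <= u by rewrite le_max lexx orbT.
    by lra.
  have fu : total_variation a u f \is a fin_num.
    apply: IH; first by rewrite au/=; lra.
    have h0 : 0 <= n%:R * (d / 2) by rewrite mulr_ge0// divr_ge0// ltW.
    by rewrite /u lerBlDr ge_max; apply/andP; split; move: tn; rewrite -natr1; lra.
  by rewrite (total_variationD _ au ut) fin_numD fu small//; lra.
move=> t tab; apply: (step (Num.bound ((t - a) / (d / 2)))) => //.
by rewrite -ler_pdivrMr ?divr_gt0// ltW// archi_boundP// divr_ge0//; lra.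
Qed.

Lemma abs_continuous_total_variation a b f : a <= b -> abs_continuous a b f ->
  abs_continuous a b (fun t => fine (total_variation a t f)).
Proof.
move=> ab acf e e0.
have e20 : 0 < e / 2 by rewrite divr_gt0.
have [d [d0 H]] := abs_continuous_total_variation_sum acf e20.
exists d; split => // n u v uv tuv sd; apply: (@le_lt_trans _ _ (e / 2)); last by lra.
rewrite -lee_fin (le_trans _ (H _ _ _ uv tuv sd))// -sumEFin; apply: lee_sum => i _.
have [au uvi vb] := uv i.
have fu : total_variation a (u i) f \is a fin_num.
  by apply: (abs_continuous_total_variation_fin ab acf); rewrite au (le_trans uvi vb).
have : total_variation a (v i) f \is a fin_num.
  by apply: (abs_continuous_total_variation_fin ab acf); rewrite vb (le_trans au uvi).
rewrite (total_variationD f au uvi) fin_numD fu/= => fuv.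
by rewrite fineD// addrAC subrr add0r ger0_norm ?fineK// fine_ge0// total_variation_ge0.
Qed.

Lemma abs_continuousB a b f g :
  abs_continuous a b f -> abs_continuous a b g -> abs_continuous a b (f \- g).
Proof.
move=> acf acg e e0; have e20 : 0 < e / 2 by rewrite divr_gt0.
have [d1 [d10 H1]] := acf _ e20; have [d2 [d20 H2]] := acg _ e20.
exists (Num.min d1 d2); split; first by rewrite lt_min d10.
move=> n u v uv tuv; rewrite lt_min => /andP[s1 s2].
rewrite (splitr e); apply: le_lt_trans (ltrD (H1 _ _ _ uv tuv s1) (H2 _ _ _ uv tuv s2)).
rewrite -big_split/=; apply: ler_sum => i _.
have -> : (f \- g) (v i) - (f \- g) (u i) = f (v i) - f (u i) - (g (v i) - g (u i)).
  by rewrite /=; ring.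
exact: ler_normB.
Qed.

Lemma abs_continuous_subitv a b a' b' f : a <= a' -> b' <= b ->
  abs_continuous a b f -> abs_continuous a' b' f.
Proof.
move=> aa bb acf e e0; have [d [d0 H]] := acf e e0; exists d; split => // n u v uv.
by apply: H => i; have [? ? ?] := uv i; split => //; lra.
Qed.

(** Precomposition with this projection extends a function from [[a, b]] to the line by constants,
    keeping continuity, monotonicity and absolute continuity. *)
Definition clamp a b t := Num.max a (Num.min t b).

Lemma clamp_itv a b t : a <= b -> a <= clamp a b t <= b.
Proof. by move=> ab; rewrite /clamp le_max lexx/= ge_max ab ge_min lexx orbT. Qed.

Lemma clamp_id a b t : a <= t <= b -> clamp a b t = t.
Proof. by rewrite /clamp => /andP[at_ tb]; rewrite min_l// max_r. Qed.

Lemma clamp_homo a b : {homo clamp a b : s t / s <= t}.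
Proof.
move=> s t st; rewrite /clamp ge_max le_max lexx/= le_max; apply/orP; right.
by rewrite le_min !ge_min st lexx orbT.
Qed.

Lemma clamp_lip a b s t : s <= t -> clamp a b t - clamp a b s <= t - s.
Proof. move=> st; rewrite /clamp; case: (lerP t b) => ?; case: (lerP s b) => ?;
  do 2 (case: (lerP a s) => ?; case: (lerP a t) => ?; case: (lerP a b) => ?); lra. Qed.

Lemma clamp_lt a b s t p : clamp a b s < p < clamp a b t -> s < p < t.
Proof.
rewrite /clamp gt_max lt_max gt_min lt_min => /andP[/andP[ap +] +].
by rewrite [p < a]ltNge (ltW ap)/= => + /andP[-> pb];
  rewrite [b < p]ltNge (ltW pb) orbF andbT.
Qed.

(** Clamping shortens lengths, and a point inside a clamped open interval lies inside the original
    one ([clamp_lt]), so disjointness survives. *)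
Lemma abs_continuous_clamp a b f : a <= b -> abs_continuous a b f ->
  forall a' b', abs_continuous a' b' (f \o clamp a b).
Proof.
move=> ab acf a' b' e e0; have [d [d0 H]] := acf e e0; exists d;
  split => // n u v uv tuv sd.
apply: (H n (clamp a b \o u) (clamp a b \o v)) => [i|i j _ _ [p [/=]]|] /=.
- have [_ uvi _] := uv i.
  by have /andP[-> _] := clamp_itv (u i) ab; have /andP[_ ->] := clamp_itv (v i) ab;
    split => //; exact: clamp_homo.
- rewrite !in_itv/= => /andP[p1 p2] /andP[p3 p4]; apply: (tuv i j) => //; exists p.
  by split; rewrite /= in_itv/=; apply: (@clamp_lt a b); exact/andP.
- by apply: le_lt_trans sd; apply: ler_sum => i _; apply: clamp_lip; have [] := uv i.
Qed.

Lemma abs_continuous_dist a b f : abs_continuous a b f -> forall e : R, 0 < e ->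
  exists d : R, 0 < d /\ forall s t, a <= s <= b -> a <= t <= b -> `|t - s| < d ->
    `|f t - f s| < e.
Proof.
move=> acf e e0; have [d [d0 H]] := acf e e0; exists d; split => // s t sab tab.
wlog st : s t sab tab / s <= t.
  move=> h; have [|/ltW ts] := leP s t; first exact: h.
  by rewrite distrC (distrC (f _)); exact: h.
rewrite ger0_norm ?subr_ge0// => ts.
have := H 1%N (fun=> s) (fun=> t); rewrite !big_ord1; apply => //.
  by move=> _; move/andP: sab => [? ?]; move/andP: tab => [? ?].
by move=> i j _ _ _; rewrite (ord1 i) (ord1 j).
Qed.

End AbsoluteContinuity.

(** * Densities of absolutely continuous functions *)

Section Density.
Context {R : realType}.
Notation mu := (@lebesgue_measure R).

Lemma lebesgue_stieltjes_itv_oc (F : cumulative R R) (a b : R) : a <= b ->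
  lebesgue_stieltjes_measure F `]a, b]%classic = (F b - F a)%:E.
Proof.
move=> ab; rewrite /lebesgue_stieltjes_measure /measure_extension/= measurable_mu_extE/=; last first.
  by exists (a, b).
by rewrite wlength_itv_bnd.
Qed.

Definition dyadic (n k : nat) : R := k%:R / 2 ^+ n.

Lemma dyadic_le n k l : (dyadic n k <= dyadic n l) = (k <= l)%N.
Proof. by rewrite /dyadic ler_pM2r ?invr_gt0 ?exprn_gt0// ler_nat. Qed.

Lemma dyadicS n k : dyadic n.+1 k.*2 = dyadic n k.
Proof.
rewrite /dyadic exprS invfM mulrA; congr (_ * _).
by rewrite -muln2 natrM mulfK// pnatr_eq0.
Qed.

Lemma dyadic_cell n (x : R) M : 0 < x -> x <= M%:R ->
  exists2 k, (k < M * 2 ^ n)%N & dyadic n k < x <= dyadic n k.+1.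
Proof.
move=> x0 xM.
have ex : exists m, x <= dyadic n m.
  by exists (M * 2 ^ n)%N; rewrite /dyadic natrM natrX mulfK// expf_neq0// pnatr_eq0.
case: (ex_minnP ex) => -[|k]; first by rewrite /dyadic mul0r leNgt x0.
move=> xk min; exists k.
  apply: min.
  by rewrite /dyadic natrM natrX mulfK// expf_neq0// pnatr_eq0.
by rewrite xk andbT ltNge; apply/negP => /min; rewrite ltnn.
Qed.

Lemma dyadic_small (e : R) : 0 < e -> exists n, forall k, dyadic n k.+1 - dyadic n k < e.
Proof.
move=> e0; exists (Num.bound e^-1) => k.
rewrite /dyadic -mulrBl -natr1 addrAC subrr add0r mul1r.
rewrite invf_plt ?posrE ?exprn_gt0//.
exact: upper_nthrootP.
Qed.

Lemma dyadic_cells_disjoint n (w : nat -> R) : (forall k, w k <= dyadic n k.+1) ->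
  trivIset setT (fun k => `]dyadic n k, w k]%classic).
Proof.
move=> wk i j _ _ [p [/=]]; rewrite !in_itv/= => /andP[p1 p2] /andP[p3 p4].
have h k l : dyadic n k < dyadic n l.+1 -> (k <= l)%N.
  by move=> kl; rewrite -ltnS ltnNge -(dyadic_le n) -ltNge.
apply/eqP; rewrite eqn_leq !h//.
  exact: lt_le_trans p3 (le_trans p2 (wk i)).
exact: lt_le_trans p1 (le_trans p4 (wk j)).
Qed.

Section Cumulative.
Variable F : cumulative R R.
Hypothesis acF : forall a b, abs_continuous a b F.

(* The union of the dyadic cells of mesh 2^-n contained in an open set increases
   to that set, so finite families of intervals suffice to bound its measure. *)
Lemma lebesgue_stieltjes_open_small (M : nat) (e : R) : 0 < e ->
  exists d : R, 0 < d /\ forall U : set R, open U -> (mu U < d%:E)%E ->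
    (lebesgue_stieltjes_measure F (U `&` `]0%R, M%:R]) <= e%:E)%E.
Proof.
move=> e0; have [d [d0 H]] := @acF 0 M%:R e e0.
exists d; split => // U oU Ud.
(* A cell not contained in [U] is replaced by an empty interval, so the index range does not depend
   on [U]. *)
pose w n k := if `[< `]dyadic n k, dyadic n k.+1]%classic `<=` U >] then dyadic n k.+1
  else dyadic n k.
have wle n k : w n k <= dyadic n k.+1 by rewrite /w; case: ifP; rewrite ?dyadic_le.
have wge n k : dyadic n k <= w n k by rewrite /w; case: ifP; rewrite ?dyadic_le.
pose C n k := `]dyadic n k, w n k]%classic.
have CU n k : C n k `<=` U.
  rewrite /C /w; case: asboolP => // _; rewrite set_itvoc0; exact: sub0set.
pose A n := \big[setU/set0]_(k < M * 2 ^ n) C n k.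
have mC n k : measurable (C n k : set (measurableTypeR R)) by exact: measurable_itv.
have mA n : measurable (A n : set (measurableTypeR R)) by apply: bigsetU_measurable.
have muA n (G : cumulative R R) : lebesgue_stieltjes_measure G (A n) =
    (\sum_(k < M * 2 ^ n) (G (w n k) - G (dyadic n k)))%:E.
  rewrite /A measure_bigsetU//; last exact: dyadic_cells_disjoint.
  by rewrite -sumEFin; apply: eq_bigr => k _; exact: lebesgue_stieltjes_itv_oc.
have AU n : A n `<=` U by rewrite /A -!bigcup_mkord => x [k _ /CU].
have Ae n : (lebesgue_stieltjes_measure F (A n) <= e%:E)%E.
  rewrite muA lee_fin; apply/ltW.
  have dyM k : (k <= M * 2 ^ n)%N -> dyadic n k <= M%:R.
    rewrite -(dyadic_le n) => /le_trans; apply.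
    by rewrite /dyadic natrM natrX mulfK// expf_neq0// pnatr_eq0.
  apply: le_lt_trans (ler_norm _) _; apply: le_lt_trans (ler_norm_sum _ _ _) _.
  apply: (H _ (fun k => dyadic n k) (fun k => w n k)) => [k|i j _ _ [p [pi pj]]|].
  - by split => //; [rewrite /dyadic divr_ge0// exprn_ge0|exact: le_trans (wle n k) (dyM _ _)].
  - apply/val_inj/(dyadic_cells_disjoint (wle n)) => //; exists p.
    by split; apply: subset_itv_oo_oc; [exact: pi|exact: pj].
  (* Lebesgue measure is the Stieltjes measure of the identity, so [muA] also computes the total
     length of the cells. *)
  - rewrite -lte_fin -(muA n idfun); apply: le_lt_trans Ud.
    by apply: le_measure; rewrite ?inE//; exact: open_measurable.
have ndA : {homo A : n m / (n <= m)%N >-> (n <= m)%O}.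
  apply/nondecreasing_seqP => n; apply/subsetPset => x.
  rewrite /A -!bigcup_mkord => -[k/= kM Cx].
  have cU : `]dyadic n k, dyadic n k.+1]%classic `<=` U.
    by move: Cx; rewrite /C /w; case: asboolP => // _; rewrite set_itvoc0.
  move: Cx; rewrite /C /= in_itv/= => /andP[kx] /le_trans/(_ (wle n k)) xk.
  have kM2 : (k.*2.+1 < M * 2 ^ n.+1)%N by rewrite expnS mulnCA mul2n ltn_Sdouble.
  (* The cell [k] of level [n] splits into the cells [k.*2] and [k.*2.+1] of level [n.+1], both
     inside [U]; the midpoint decides which one holds [x]. *)
  have [xl|xl] := leP x (dyadic n.+1 k.*2.+1).
    exists k.*2; first exact: ltn_trans kM2.
    rewrite /C /= in_itv/= dyadicS kx/= /w; case: asboolP => //; case.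
    apply: subset_trans cU => z/=; rewrite !in_itv/= dyadicS => /andP[-> /le_trans];
      apply.
    by rewrite -(dyadicS n k.+1) dyadic_le.
  exists k.*2.+1 => //.
  rewrite /C /= in_itv/= xl/= /w; case: asboolP => [_|].
    by rewrite -doubleS dyadicS.
  case; apply: subset_trans cU => z/=; rewrite !in_itv/= -doubleS dyadicS => /andP[+ ->].
  rewrite andbT; apply: le_lt_trans.
  by rewrite -(dyadicS n k) dyadic_le.
have UA : U `&` `]0, M%:R]%classic `<=` \bigcup_n A n.
  move=> x [Ux]; rewrite /= in_itv/= => /andP[x0 xM].
  have [eps/= eps0 xeps] := (@nbhs_ballP _ _ _ _).1 (open_nbhs_nbhs (conj oU Ux)).
  have [n nk] := dyadic_small eps0; exists n => //.
  have [k kM /andP[kx xk]] := dyadic_cell n x0 xM.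
  rewrite /A -!bigcup_mkord; exists k => //=.
  rewrite /C/= in_itv/= kx/= /w; case: asboolP => //; case => z /=.
  rewrite in_itv/= => /andP[kz zk]; apply: xeps; rewrite /ball/=.
  have := nk k; rewrite ltr_norml => ?; apply/andP; split; lra.
have mUA : measurable (\bigcup_n A n :
  set (measurableTypeR R)) by apply: bigcup_measurable => n _; exact: mA.
apply: le_trans (_ : (lebesgue_stieltjes_measure F (\bigcup_n A n) <= _)%E).
  apply: le_measure; rewrite ?inE//; apply: measurableI; first exact: open_measurable.
  exact: measurable_itv.
have cv := @nondecreasing_cvg_mu _ _ _ (lebesgue_stieltjes_measure F) A mA mUA ndA.
rewrite -(cvg_lim _ cv)//; apply: lime_le.
  by apply/cvg_ex; eexists; exact: cv.
by apply: nearW => n; exact: Ae.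
Qed.

(** Outer regularity encloses the null set in an open set of Lebesgue measure below [d], to which
    the previous bound applies. *)
Lemma lebesgue_stieltjes_dominates (T : R) (A : set R) : measurable A -> mu A = 0%E ->
  lebesgue_stieltjes_measure F (A `&` `]0%R, T]) = 0%E.
Proof.
move=> mA A0; apply/eqP; rewrite eq_le measure_ge0 andbT.
apply/lee_addgt0Pr => e e0; rewrite add0e.
pose M := Num.bound `|T|.
have [d [d0 H]] := lebesgue_stieltjes_open_small M e0.
have Afin : (mu A < +oo)%E by rewrite A0 ltry.
have [U [oU AU UA]] := lebesgue_regularity_outer mA Afin d0.
have Ud : (mu U < d%:E)%E.
  rewrite -(setDUK AU) measureU// ?setDIK//; [|by apply: measurableD => //;
    exact: open_measurable].
  by move: UA; rewrite -[X in (X < _)%E]add0e -[X in (X + _)%E]A0.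
apply: le_trans (H U oU Ud); apply: le_measure; rewrite ?inE.
- by apply: measurableI => //; exact: measurable_itv.
- by apply: measurableI; [exact: open_measurable|exact: measurable_itv].
apply: setISS => // x /=; rewrite !in_itv/= => /andP[-> xT]/=.
by rewrite (le_trans xT)// (le_trans (ler_norm T))// ltW// archi_boundP.
Qed.

End Cumulative.

Lemma abs_continuous_right_continuous (G : R -> R) :
  (forall a b, abs_continuous a b G) -> right_continuous G.
Proof.
move=> acG x; apply/cvgrPdist_lt => e e0.
have [d [d0 H]] := abs_continuous_dist (acG x (x + 1)) e0.
near=> t.
have xt : x < t by near: t; exact: nbhs_right_gt.
have td : t < x + d by near: t; apply: nbhs_right_lt; lra.
have t1 : t < x + 1 by near: t; apply: nbhs_right_lt; lra.
rewrite distrC; apply: H; [lra|lra|].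
by rewrite gtr0_norm; lra.
Unshelve. all: by end_near. Qed.

(** The Stieltjes measure of the clamped [F], restricted to []0, T]], is finite and dominated by
    Lebesgue measure; [g] is its Radon-Nikodym derivative. *)
Lemma nondecreasing_abs_continuous_density (T : R) (F : R -> R) : 0 <= T ->
  {in `[0, T] &, {homo F : s t / s <= t}} -> abs_continuous 0 T F ->
  exists g : R -> R, mu.-integrable setT (EFin \o g) /\
    forall t, 0 <= t <= T -> F t - F 0 = \int[mu]_(x in `[0, t]) g x.
Proof.
move=> T0 ndF acF.
have acG := abs_continuous_clamp T0 acF.
pose G0 := F \o clamp 0 T.
have ndG : nondecreasing G0.
  by move=> s t st; apply: ndF; rewrite ?in_itv/= ?clamp_itv//; exact: clamp_homo.
pose Gi := isCumulative.Build R _ R G0 ndG (abs_continuous_right_continuous acG).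
pose G : cumulative R R := HB.pack G0 Gi.
pose D := `]0, T]%classic : set (measurableTypeR R).
have mD : measurable D by exact: measurable_itv.
have Dfin : (lebesgue_stieltjes_measure G D < +oo)%E.
  by rewrite lebesgue_stieltjes_itv_oc// ltry.
pose nu := mfrestr mD Dfin : {finite_measure set (measurableTypeR R) -> \bar R}.
have numu : nu `<< (mu : {sigma_finite_measure set (measurableTypeR R) -> \bar R}).
  apply/null_content_dominatesP => A mA A0.
  exact: lebesgue_stieltjes_dominates.
pose f := Radon_Nikodym_SigmaFinite.f nu (mu :
  {sigma_finite_measure set (measurableTypeR R) -> \bar R}).
have ffin x : f x \is a fin_num by exact: Radon_Nikodym_SigmaFinite.f_fin_num.
have fE : EFin \o (fine \o f) = f by apply/funext => x /=; rewrite fineK.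
exists (fine \o f); split.
  by rewrite fE; exact: Radon_Nikodym_SigmaFinite.f_integrable.
move=> t /andP[t0 tT].
have mt : measurable (`]0, t]%classic : set (measurableTypeR R)) by exact: measurable_itv.
have := Radon_Nikodym_SigmaFinite.f_integral numu mt.
rewrite {1}/nu /= /mfrestr /mrestr setIidl; last first.
  by apply: subset_itvl; rewrite bnd_simp.
rewrite lebesgue_stieltjes_itv_oc// /G/= /G0/= !clamp_id ?lexx ?t0//.
rewrite -/f -fE => /(congr1 fine) /= ->.
rewrite -Rintegral_itv_obnd_cbnd//.
rewrite fE; apply: (integrableS measurableT) => //.
exact: Radon_Nikodym_SigmaFinite.f_integrable.
Qed.

(* Absolute continuity passes to the total variation F, and f = F - (F - f) is a
   difference of nondecreasing functions, to which Radon-Nikodym applies. *)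
Lemma abs_continuous_density (T : R) (f : R -> R) : 0 <= T -> abs_continuous 0 T f ->
  exists g : R -> R, [/\ mu.-integrable setT (EFin \o g),
    forall s t, 0 <= s -> s <= t -> t <= T -> f t - f s = \int[mu]_(x in `[s, t]) g x &
    {ae mu, forall t, 0 < t < T -> derive1 f t = g t}].
Proof.
move=> T0 acf.
pose F t := fine (total_variation 0 t f).
have acF : abs_continuous 0 T F by exact: abs_continuous_total_variation.
have Ffin t : 0 <= t <= T -> total_variation 0 t f \is a fin_num.
  exact: abs_continuous_total_variation_fin.
have FD s t : 0 <= s -> s <= t -> t <= T -> `|f t - f s| <= F t - F s.
  move=> s0 st tT.
  have : total_variation 0 t f \is a fin_num by apply: Ffin; rewrite (le_trans s0 st).
  rewrite /F (total_variationD f s0 st) fin_numD => /andP[fs ft].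
  by rewrite fineD// addrAC subrr add0r -lee_fin fineK// total_variation_ge.
have [g1 [ig1 Hg1]] : exists g : R -> R, mu.-integrable setT (EFin \o g) /\
    forall t, 0 <= t <= T -> F t - F 0 = \int[mu]_(x in `[0, t]) g x.
  apply: nondecreasing_abs_continuous_density => // s t; rewrite !in_itv/=.
  move=> /andP[s0 sT] /andP[t0 tT] st.
  by rewrite -subr_ge0 (le_trans (normr_ge0 _) (FD _ _ s0 st tT)).
have [g2 [ig2 Hg2]] : exists g : R -> R, mu.-integrable setT (EFin \o g) /\
    forall t, 0 <= t <= T -> (F \- f) t - (F \- f) 0 = \int[mu]_(x in `[0, t]) g x.
  apply: nondecreasing_abs_continuous_density => //; last exact: abs_continuousB.
  move=> s t; rewrite !in_itv/= => /andP[s0 sT] /andP[t0 tT] st.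
  have := FD _ _ s0 st tT; rewrite ler_norml => /andP[_]; lra.
pose g := g1 \- g2.
have ig : mu.-integrable setT (EFin \o g).
  by rewrite (_ : EFin \o g = (EFin \o g1) \- (EFin \o g2))%E//; exact: integrableB.
have igS (A : set R) : measurable A -> mu.-integrable A (EFin \o g).
  by move=> mA; exact: (integrableS measurableT).
have f0E t : 0 <= t <= T -> f t - f 0 = \int[mu]_(x in `[0, t]) g x.
  move=> tT; rewrite RintegralB//; first last.
  - by apply: (integrableS measurableT).
  - by apply: (integrableS measurableT).
  by rewrite -Hg1// -Hg2//=; ring.
exists g; split => //.
  move=> s t s0 st tT.
  have -> : f t - f s = (f t - f 0) - (f s - f 0) by ring.
  rewrite !f0E ?s0 ?(le_trans s0 st) ?(le_trans st tT)//.
  rewrite Rintegral_itvB ?bnd_simp//; last exact: igS.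
  by rewrite Rintegral_itv_obnd_cbnd//; exact: igS.
(* Lebesgue differentiation gives almost everywhere the derivative of the primitive of [g], with
   which [f - f 0] coincides near every interior point. *)
have lig : locally_integrable setT g by apply: open_integrable_locally => //;
  exact: openT.
have := @FTC1 _ g (BLeft 0) (fun y => igS _ (measurable_itv _)) lig.
apply: filterS; first exact: (ae_filter_ringOfSetsType mu).
move=> t H /andP[t0 tT].
have [|dG dGE] := H.
  by rewrite lte_fin.
rewrite -dGE !derive1E.
rewrite (@near_eq_derive R R R f (cst (f 0) + (fun x => \int[mu]_(t in `[0, x]) g t))).
  by rewrite deriveD// derive_cst add0r.
near=> x.
have x0 : 0 <= x by apply/ltW; near: x; exact: lt_nbhsr.
have xT : x <= T by apply/ltW; near: x; exact: lt_nbhsl.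
by rewrite /= /cst/= fctE -f0E ?x0//; ring.
Unshelve. all: by end_near. Qed.

End Density.

(** Meant for integrands without a measurability proof, such as those built from [derive1] or from
    the state under an arbitrary control. The integral of a nonnegative function is a supremum over
    the simple functions below it, which is monotone by inclusion. *)
Lemma ge0_le_integral_nonmeasurable d (T : measurableType d) (R : realType)
    (mu : {measure set T -> \bar R}) (D : set T) (f g : T -> \bar R) :
  (forall x, D x -> (0 <= f x)%E) -> (forall x, D x -> (f x <= g x)%E) ->
  (\int[mu]_(x in D) f x <= \int[mu]_(x in D) g x)%E.
Proof.
move=> f0 fg; have g0 x : D x -> (0 <= g x)%E.
  by move=> Dx; exact: le_trans (f0 x Dx) (fg x Dx).
rewrite !ge0_integralE//; apply: le_ereal_sup => _ [k kf <-]; exists k => // x.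
apply: le_trans (kf x) _; rewrite /patch; case: ifPn => // /set_mem; exact: fg.
Qed.

Lemma bounded_integrable_itv (R : realType) (s t M : R) (f : R -> R) :
  measurable_fun `[s, t] f -> (forall u, s <= u <= t -> `|f u| <= M) ->
  (@lebesgue_measure R).-integrable `[s, t] (EFin \o f).
Proof.
move=> mf fM; apply: measurable_bounded_integrable => //=.
  by rewrite lebesgue_measure_itv/=; case: ifP => _; rewrite ?ltry.
exists M; split; first exact: num_real.
by move=> x Mx u /=; rewrite in_itv/= => /fM /le_trans; apply; exact: ltW.
Qed.

Lemma integrable_cst_itv (R : realType) (s t k : R) :
  (@lebesgue_measure R).-integrable `[s, t] (EFin \o cst k).
Proof. exact: (@bounded_integrable_itv _ _ _ `|k|). Qed.

(** * Energy of absolutely continuous paths *)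

Section Energy.
Context {R : realType}.
Variables (c1 c2 : R).
Hypotheses (c1_gt0 : 0 < c1) (c2_gt0 : 0 < c2).
Notation mu := (@lebesgue_measure R).
Notation c := (ceff c1 c2).

Lemma ceff_gt0 : 0 < c.
Proof. by rewrite invr_gt0 addr_gt0// invr_gt0. Qed.

Lemma ceff_sum : c / c1 + c / c2 = 1.
Proof. by rewrite -mulrDr mulVf// gt_eqF// addr_gt0// invr_gt0. Qed.

(* Since k is arbitrary, this linear bound replaces the minimal cost c * (a - b) ^+ 2
   of the velocity a - b, and it integrates exactly along any path. *)
Lemma energy_young (a b k : R) :
  2 * c * k * (a - b) - c * k ^+ 2 <= c1 * a ^+ 2 + c2 * b ^+ 2.
Proof.
rewrite -subr_ge0.
have -> : c1 * a ^+ 2 + c2 * b ^+ 2 - (2 * c * k * (a - b) - c * k ^+ 2) =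
   c1 * (a - c / c1 * k) ^+ 2 + c2 * (b + c / c2 * k) ^+ 2.
  have -> : c * k ^+ 2 = c * (c / c1 + c / c2) * k ^+ 2 by rewrite ceff_sum mulr1.
  field.
  by rewrite (gt_eqF c1_gt0) (gt_eqF c2_gt0).
by rewrite addr_ge0// mulr_ge0 ?sqr_ge0// ltW.
Qed.

(** [E] is the primitive of the energy of the densities of [psi], and its increments integrate
    [energy_young]. The first alternative sets aside infinite energy, for which upper bounds on the
    game cost are immediate. *)
Lemma path_cost_minorant (T : R) (psi : path2 R) : 0 <= T ->
  abs_continuous 0 T psi.1 -> abs_continuous 0 T psi.2 ->
  path_cost c1 c2 T psi = +oo%E \/
  exists E : R -> R, [/\ E 0 = 0, ((E T)%:E <= path_cost c1 c2 T psi)%E &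
    forall k s t, 0 <= s -> s <= t -> t <= T ->
      2 * c * k * (psi.1 t - psi.2 t - (psi.1 s - psi.2 s)) - c * k ^+ 2 * (t - s)
        <= E t - E s].
Proof.
move=> T0 ac1 ac2.
have [g1 [ig1 fg1 dg1]] := abs_continuous_density T0 ac1.
have [g2 [ig2 fg2 dg2]] := abs_continuous_density T0 ac2.
rewrite /path_cost asboolT//.
set J := (X in X = +oo%E \/ _).
have [->|Joo] := eqVneq J +oo%E; [by left|right].
pose e t := c1 * g1 t ^+ 2 + c2 * g2 t ^+ 2.
have e0 t : 0 <= e t by rewrite addr_ge0// mulr_ge0 ?sqr_ge0// ltW.
have mg1 : measurable_fun setT g1 by apply/measurable_EFinP; exact: measurable_int ig1.
have mg2 : measurable_fun setT g2 by apply/measurable_EFinP; exact: measurable_int ig2.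
have me : measurable_fun setT e.
  by apply: measurable_funD; apply: measurable_funM => //; exact: measurable_funX.
have ndg : mu.-negligible (~` [set t | 0 < t < T ->
  derive1 psi.1 t = g1 t /\ derive1 psi.2 t = g2 t]).
  apply: (negligibleS _ (negligibleU dg1 dg2)) => t /=.
  by move=> h; apply/not_andP => -[h1 h2]; apply: h => ht; split; [exact: h1|exact: h2].
have [A [mA A0 nA]] := ndg.
(* The endpoints join the exceptional set because [derive1] there also sees [psi] outside
   [[0, T]]. *)
pose B := A `|` [set 0; T].
have mB : measurable B.
  by apply: measurableU => //; apply: measurableU; exact: measurable_set1.
have B0 : mu B = 0%E.
  apply/eqP; rewrite eq_le measure_ge0 andbT.
  have m2 : measurable [set 0; T] by apply: measurableU; exact: measurable_set1.
  apply: (@le_trans _ _ (mu A + mu [set 0%R; T])%E); first exact: measureU2.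
  rewrite A0 add0e; apply: (@le_trans _ _ (mu [set 0%R] + mu [set T])%E).
    by apply: measureU2; exact: measurable_set1.
  by rewrite !lebesgue_measure_set1 adde0.
(* Setting the energy to [0] on the null set [B] keeps its integral and makes it a lower bound of
   the integrand of [path_cost] at every point. *)
pose e1 := e \_ (~` B).
have e10 t : 0 <= e1 t by rewrite /e1 /patch; case: ifP.
have me1 : measurable_fun setT e1.
  by apply/(measurable_restrictT _ _).1; [exact: measurableC|exact: measurable_funS me].
have eJ : (\int[mu]_(t in `[0%R, T]) (e t)%:E <= J)%E.
  have -> : (\int[mu]_(t in `[0%R, T]) (e t)%:E = \int[mu]_(t in `[0%R, T]) (e1 t)%:E)%E.
    apply: ge0_ae_eq_integral => //.
    - by apply/measurable_EFinP; exact: measurable_funS me.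
    - by apply/measurable_EFinP; exact: measurable_funS me1.
    - by move=> x _; rewrite lee_fin.
    - by move=> x _; rewrite lee_fin.
    exists B; split => // t /= /not_implyP[_ ne]; apply: contrapT => Bt; apply: ne.
    by rewrite /e1 /patch mem_set.
  apply: ge0_le_integral_nonmeasurable => t; rewrite /= in_itv/= => /andP[t0 tT];
    rewrite lee_fin//.
  rewrite /e1 /patch; case: ifPn => [/set_mem Bt|_]; last first.
    by rewrite addr_ge0// mulr_ge0 ?sqr_ge0// ltW.
  have /not_orP[At /not_orP[tn0 tnT]] := Bt.
  have dg : 0 < t < T -> derive1 psi.1 t = g1 t /\ derive1 psi.2 t = g2 t.
    by have := contra_not (@nA t) At => /contrapT.
  have [|-> ->] := dg; last by [].
  by rewrite !lt_neqAle t0 tT !andbT; apply/andP; split; apply/eqP => // h; apply: tn0.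
have ie : mu.-integrable `[0, T] (EFin \o e).
  apply/integrableP; split; first by apply/measurable_EFinP; exact: measurable_funS me.
  apply: le_lt_trans (_ : (J < +oo)%E); last by rewrite ltey.
  by apply: le_trans eJ; under eq_integral do rewrite /= ger0_norm//.
have iS (f : R -> R) s t : mu.-integrable setT (EFin \o f) ->
  mu.-integrable `[s, t] (EFin \o f).
  by move=> iF; apply: (integrableS measurableT).
exists (fun t => \int[mu]_(u in `[0, t]) e u); split.
- by rewrite set_itv1 Rintegral_set1.
- rewrite /Rintegral fineK//; exact: integrable_fin_num.
move=> k s t s0 st tT.
have ist : mu.-integrable `[s, t] (EFin \o e).
  by apply: integrableS ie => //; apply: subset_itvScc.
have -> : \int[mu]_(u in `[0, t]) e u - \int[mu]_(u in `[0,
  s]) e u = \int[mu]_(u in `[s, t]) e u.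
  rewrite Rintegral_itvB ?bnd_simp//; first last.
    by apply: integrableS ie => //; apply: subset_itvScc.
  by rewrite Rintegral_itv_obnd_cbnd//; apply: integrableS ist => //;
    exact: subset_itv_oc_cc.
have -> : 2 * c * k * (psi.1 t - psi.2 t - (psi.1 s - psi.2 s)) - c * k ^+ 2 * (t - s) =
   \int[mu]_(u in `[s, t]) (2 * c * k * (g1 u - g2 u) - c * k ^+ 2).
  have i12 : mu.-integrable `[s, t] (EFin \o (fun u => g1 u - g2 u)).
    by apply: (@integrableB _ _ _ mu `[s, t] _ (EFin \o g1) (EFin \o g2)) => //;
      exact: iS.
  rewrite RintegralB//; first last.
  - exact: integrable_cst_itv.
  - by apply: (@integrableZl _ _ _ mu `[s, t] _ (2 * c * k) (EFin \o (fun u =>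
    g1 u - g2 u))).
  rewrite RintegralZl//.
  rewrite RintegralB//; [|exact: iS..].
  rewrite -fg1// -fg2// Rintegral_cst//= lebesgue_measure_itv/= lte_fin.
  have [stl|ts] := ltP s t; first by rewrite /=; ring.
  have -> : s = t by lra.
  by rewrite /=; ring.
apply: le_Rintegral => //.
  apply: (@integrableB _ _ _ mu `[s, t] _ (EFin \o (fun u =>
    2 * c * k * (g1 u - g2 u))) (EFin \o cst (c * k ^+ 2))) => //.
    apply: (@integrableZl _ _ _ mu `[s, t] _ (2 * c * k) (EFin \o (fun u =>
      g1 u - g2 u))) => //.
    by apply: (@integrableB _ _ _ mu `[s, t] _ (EFin \o g1) (EFin \o g2)) => //;
      exact: iS.
  exact: integrable_cst_itv.
by move=> u _; exact: energy_young.
Qed.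

End Energy.

(** * Calculus *)

Section RealAnalysis.
Context {R : realType}.
Notation mu := (@lebesgue_measure R).
Implicit Types (f g : R -> R) (a b t u : R).

Lemma is_derive_within (A : set R) f (p q t l : R) : p < t < q ->
  (forall s, p < s < q -> A s) -> has_derivative_within A f t l -> is_derive t 1 f l.
Proof.
move=> /andP[pt tq] As Hl.
suff cv : h^-1 *: (f (h *: 1 + t) - f t) @[h --> 0^'] --> l.
  by apply: DeriveDef; [apply/cvg_ex; exists l|exact/cvg_lim].
apply/cvgrPdist_lt => e e0; move/cvgrPdist_lt : Hl => /(_ e e0).
rewrite near_withinE near_withinE => /nbhs_ballP[d/= d0 Hd].
near=> h.
have h0 : h != 0 by near: h; exact: nbhs_dnbhs_neq.
have hd : `|h| < d by near: h; exact: dnbhs0_lt.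
have hpq : `|h| < Num.min (t - p) (q - t).
  by near: h; apply: dnbhs0_lt; rewrite lt_min !subr_gt0 pt.
have := Hd (h + t); rewrite addrK /GRing.scale/= mulr1; apply.
- by rewrite /ball/= opprD addrCA subrr addr0 normrN.
- by apply: contra_neq h0 => /eqP; rewrite -subr_eq0 addrK => /eqP.
apply: As; move: hpq; rewrite lt_min !ltr_norml; lra.
Unshelve. all: by end_near. Qed.

Lemma integrable_continuous_itv g s t : continuous g ->
  mu.-integrable `[s, t] (EFin \o g).
Proof.
move=> cg; apply: continuous_compact_integrable; first exact: segment_compact.
exact: continuous_subspaceT.
Qed.

(** A base point below both [0] and [u] removes the case distinction on the sign of [u]. *)
Lemma oriented_integralE g a u : continuous g -> a <= 0 -> a <= u ->
  oriented_integral g u = \int[mu]_(x in `[a, u]) g x - \int[mu]_(x in `[a, 0]) g x.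
Proof.
move=> cg a0 au; rewrite /oriented_integral; case: ifPn => [u0|].
  rewrite Rintegral_itvB ?bnd_simp//; last exact: integrable_continuous_itv.
  rewrite Rintegral_itv_obnd_cbnd//.
  by apply: integrableS (integrable_continuous_itv 0 u cg) => //; exact: subset_itv_oc_cc.
rewrite -ltNge => u0; rewrite -opprB; congr (- _).
rewrite Rintegral_itvB ?bnd_simp//; [|exact: integrable_continuous_itv|exact: ltW].
rewrite Rintegral_itv_obnd_cbnd//.
by apply: integrableS (integrable_continuous_itv u 0 cg) => //; exact: subset_itv_oc_cc.
Qed.

Lemma oriented_integralB g s t : continuous g -> s <= t ->
  oriented_integral g t - oriented_integral g s = \int[mu]_(x in `[s, t]) g x.
Proof.
move=> cg st; pose a := Num.min s 0.
have a0 : a <= 0 by rewrite /a ge_min lexx orbT.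
have as_ : a <= s by rewrite /a ge_min lexx.
rewrite !(oriented_integralE cg a0) ?(le_trans as_)// opprB addrA subrK.
rewrite Rintegral_itvB ?bnd_simp//; last exact: integrable_continuous_itv.
rewrite Rintegral_itv_obnd_cbnd//.
by apply: integrableS (integrable_continuous_itv s t cg) => //; exact: subset_itv_oc_cc.
Qed.

Lemma oriented_integral_derive g u : continuous g ->
  is_derive u 1 (oriented_integral g) (g u).
Proof.
move=> cg; pose a := Num.min u 0 - 1.
have au : a < u by rewrite /a; case: (leP u 0) => ?; lra.
have a0 : a < 0 by rewrite /a; case: (leP u 0) => ?; lra.
have [|dF dFE] := @continuous_FTC1_closed _ g a u (u + 1) _
  (integrable_continuous_itv _ _ cg) au (cg u); first by lra.
apply: (@near_eq_is_derive R R R ((fun x => \int[mu]_(t in `[a, x]) g t) +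
   cst (- \int[mu]_(t in `[a, 0]) g t))).
  near=> x; rewrite [RHS](@oriented_integralE _ a)//; [exact: ltW|].
  by apply/ltW; near: x; exact: lt_nbhsr.
rewrite -[X in is_derive _ _ _ X]addr0; apply: is_deriveD.
by apply: DeriveDef => //; rewrite -derive1E.
Unshelve. all: by end_near. Qed.

Lemma is_derive_continuous f df : (forall u, is_derive u 1 f (df u)) -> continuous f.
Proof.
by move=> Hf u; apply/differentiable_continuous/derivable1_diffP; have [] := Hf u.
Qed.

Lemma mean_value f df s t : (forall u, is_derive u 1 f (df u)) -> s <= t ->
  exists2 u, s <= u <= t & f t - f s = df u * (t - s).
Proof.
move=> Hf st; have cf : {within `[s, t], continuous f}.
  exact/continuous_subspaceT/(is_derive_continuous Hf).
have [u + uE] := MVT_segment st (fun x _ => Hf x) cf.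
by rewrite in_itv/=; exists u.
Qed.

End RealAnalysis.

(** * Skorohod reflection *)

Section SkorohodFlat.
Context {R : realType}.
Variables (beta : R) (w phi : R -> R) (eta1 eta2 : cumulative R R).
Hypothesis sk : is_skorohod 0 beta w phi eta1 eta2.
Notation nu := (lebesgue_stieltjes_measure eta2).

(** The indicator of [A] lies below the integrand of the complementarity condition for [eta2], whose
    integral is [0]. *)
Lemma skorohod_null (A : set R) : measurable A -> A `<=` `[0, +oo[ ->
  (forall u, A u -> phi u < beta) -> nu A = 0%E.
Proof.
move=> mA A0 Ab; have [_ _ phi_itv _ int0] := sk.
apply/eqP; rewrite eq_le measure_ge0 andbT -int0.
have -> : nu A = (\int[nu]_(t in `[0%R, +oo[) (\1_A t)%:E)%E.
  by rewrite integral_indic//= setIidl.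
apply: ge0_le_integral_nonmeasurable => t /=; rewrite in_itv/= andbT => t0.
  by rewrite lee_fin indicE.
rewrite lee_fin !indicE; case: (boolP (t \in A)) => // /set_mem At.
rewrite mem_set//= in_itv/= Ab// andbT.
by have := phi_itv t t0; rewrite in_itv/= => /andP[].
Qed.

Lemma skorohod_flat s t : 0 <= s -> s <= t ->
  (forall u, s < u <= t -> phi u < beta) -> eta2 t = eta2 s.
Proof.
move=> s0 st phib; have : nu `]s, t]%classic = 0%E.
  apply: skorohod_null => [//|u /=|u /=]; rewrite in_itv/=; last exact: phib.
  by move=> /andP[su _]; rewrite in_itv/= andbT ltW// (le_lt_trans s0).
by rewrite lebesgue_stieltjes_itv_oc// => -[] /eqP; rewrite subr_eq0 => /eqP.
Qed.

(** The measure of [eta2] has no atom at [t] when [phi t < beta]; continuity from above along []t -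
    n.+1%:R^-1, t]] turns this into left continuity. At [t = 0] the bound reaches negative times,
    where [eta2] vanishes, and so excludes an initial jump. *)
Lemma skorohod_left_continuous t e : 0 <= t -> phi t < beta -> 0 < e ->
  exists d, 0 < d /\ forall s, t - d <= s <= t -> eta2 t - eta2 s < e.
Proof.
move=> t0 phib e0.
have nut : nu [set t] = 0%E.
  apply: skorohod_null => [|u ->|u ->//]; first exact: measurable_set1.
  by rewrite /= in_itv/= t0.
pose A n := `]t - n.+1%:R^-1, t]%classic.
have capA : \bigcap_n A n = [set t].
  apply/seteqP; split => [u /= Au|u -> n _ /=]; last first.
    by rewrite /A /= in_itv/= lexx ltrBlDr ltrDl invr_gt0 ltr0n.
  apply/eqP; rewrite eq_le; apply/andP; split.
    by have := Au 0%N I; rewrite /A /= in_itv/= => /andP[].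
  rewrite leNgt; apply/negP => ut.
  have tu0 : 0 < t - u by rewrite subr_gt0.
  have [n nE] : exists n : nat, n.+1%:R^-1 < t - u.
    exists (Num.bound (t - u)^-1); rewrite invf_plt ?posrE ?ltr0n//.
    apply: lt_trans (_ : (Num.bound (t - u)^-1)%:R < _); last by rewrite ltr_nat.
    by apply: archi_boundP; rewrite invr_ge0 ltW.
  have := Au n I; rewrite /A /= in_itv/= => /andP[+ _].
  by rewrite ltrBlDr -ltrBlDl => /(lt_trans nE); rewrite ltxx.
have mA n : measurable (A n : set (measurableTypeR R)) by exact: measurable_itv.
have tn n : t - n.+1%:R^-1 <= t by rewrite lerBlDr lerDl invr_ge0.
have nuA n : nu (A n) = (eta2 t - eta2 (t - n.+1%:R^-1))%:E.
  exact: lebesgue_stieltjes_itv_oc.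
have A0 : (nu (A 0%N) < +oo)%E by rewrite nuA ltry.
have mcap : measurable (\bigcap_n A n : set (measurableTypeR R)).
  by rewrite capA; exact: measurable_set1.
have niA : {homo A : n m / (n <= m)%N >-> (m <= n)%O}.
  apply/nonincreasing_seqP => n; apply/subsetPset => u; rewrite /A /= !in_itv/=.
  move=> /andP[un ->]; rewrite andbT (le_lt_trans _ un)// lerD2l lerN2.
  by rewrite lef_pV2 ?posrE ?ltr0n// ler_nat.
have : (nu \o A) n @[n --> \oo] --> 0%E.
  by rewrite -nut -capA; exact: nonincreasing_cvg_mu.
move=> /fine_cvgP[_].
move=> /cvgrPdist_lt/(_ _ e0)[n _ /(_ n (leqnn n))] /=.
rewrite nuA/= sub0r normrN ger0_norm ?subr_ge0; last exact: cumulative_is_nondecreasing.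
move=> ne; exists n.+1%:R^-1; split; first by rewrite invr_gt0 ltr0n.
move=> s /andP[ns _]; apply: le_lt_trans ne; rewrite lerD2l lerN2.
exact: cumulative_is_nondecreasing.
Qed.

Lemma skorohod_initial : phi 0 < beta -> eta2 0 = 0.
Proof.
have [eta0 _ _ _ _] := sk => phib.
have eta20 : 0 <= eta2 0.
  apply: (@le_trans _ _ (eta2 (-1))); first by rewrite (eta0 (-1) (ltrN10 R)).2.
  exact/cumulative_is_nondecreasing/lerN10.
apply/eqP; rewrite eq_le eta20 andbT; apply/ler_addgt0Pr => e e0; rewrite add0r.
have [d [d0 Hd]] := skorohod_left_continuous (lexx 0) phib e0.
have := Hd (- d); rewrite add0r lexx oppr_le0 (ltW d0) => /(_ isT).
by rewrite (eta0 (- d) _).2 ?oppr_lt0// subr0 => /ltW.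
Qed.

End SkorohodFlat.

(** * Monotonicity from local slopes, last contact with the barrier, attainment of the hitting
    time *)

Section Preliminaries.
Context {R : realType}.
Notation mu := (@lebesgue_measure R).

(* Stands in for the chain rule in the verification argument, where F involves
   a function of an absolutely continuous path. *)
Lemma local_upper_slope_le0 (F : R -> R) (s t : R) : s <= t ->
  (forall k v, 0 < k -> s <= v <= t -> exists d, 0 < d /\
    forall p q, s <= p -> p <= q -> q <= t -> v - d < p -> q < v + d ->
      F q - F p <= k * (q - p)) ->
  F t <= F s.
Proof.
move=> st HF.
suff Hk k : 0 < k -> F t <= F s + k * (t - s).
  apply/ler_addgt0Pr => e e0.
  have ts0 : 0 < t - s + 1 by lra.
  apply: le_trans (Hk (e / (t - s + 1)) _) _; first by rewrite divr_gt0.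
  rewrite lerD2l -mulrA -[leRHS]mulr1 ler_wpM2l ?(ltW e0)//.
  by rewrite mulrC ler_pdivrMr// mul1r; lra.
(* Continuous induction: the bound with slope [k] propagates past the supremum of the times at which
   it holds, unless this supremum is [t]. *)
move=> k0; pose S := [set u | s <= u <= t /\ F u <= F s + k * (u - s)].
have Ss : S s by split; [rewrite lexx|rewrite subrr mulr0 addr0].
have ubS : ubound S t by move=> u [/andP[]].
have hS : has_sup S by split; [exists s|exists t].
have sv : s <= sup S by exact: sup_upper_bound.
have vt : sup S <= t by apply: ge_sup => //; exists s.
have [d [d0 Hd]] := HF k (sup S) k0 (introT andP (conj sv vt)).
have [p Sp pd] := sup_adherent d0 hS.
have [/andP[sp pt] Fp] := Sp.
have pv : p <= sup S by exact: sup_upper_bound.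
have inS q : sup S <= q -> q <= t -> q < sup S + d -> S q.
  move=> vq qt qd; split; first by rewrite qt (le_trans sv).
  have := Hd p q sp (le_trans pv vq) qt pd qd.
  by move: Fp; lra.
have [vltt|tv] := ltP (sup S) t; last first.
  have [_] : S (sup S) by apply: inS => //; rewrite ltrDl.
  by have -> : sup S = t by lra.
pose q := Num.min (sup S + d / 2) t.
have vq : sup S < q by rewrite lt_min vltt ltrDl divr_gt0.
have : S q.
  apply: inS; [exact: ltW|by rewrite ge_min lexx orbT|].
  by rewrite gt_min; apply/orP; left; lra.
by move=> /(sup_upper_bound hS); lra.
Qed.

(** [F] stands for the running cost of a reflected path, bounded by a constant before the last
    contact and by a continuous function after it. It lies below the sum of the zero extensions [f1]
    and [f2]; their overlap at [s] only enlarges the bound. *)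
Lemma ge0_integral_two_pieces_le (F G : R -> R) (k s t : R) : 0 <= s -> s <= t ->
  0 <= k ->
  continuous G -> (forall u, 0 <= G u) ->
  (forall u, 0 <= u <= t -> 0 <= F u) ->
  (forall u, 0 <= u < s -> F u <= k) -> (forall u, s <= u <= t -> F u <= G u) ->
  (\int[mu]_(u in `[0%R, t]) (F u)%:E <= (k * s + \int[mu]_(u in `[s, t]) G u)%:E)%E.
Proof.
move=> s0 st k0 cG G0 F0 Fk FG.
have mG : measurable_fun setT G by exact: continuous_measurable_fun.
pose f1 : R -> \bar R := (EFin \o cst k) \_ `[0, s];
  pose f2 : R -> \bar R := (EFin \o G) \_ `[s, t].
apply: (@le_trans _ _ (\int[mu]_(u in `[0%R, t]) (f1 u + f2 u))%E).
  apply: ge0_le_integral_nonmeasurable => u /=; rewrite in_itv/= => /andP[u0 ut].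
    by rewrite lee_fin F0// u0.
  rewrite /f1 /f2 /patch !mem_setE !in_itv/= u0 ut/= andbT.
  have [us|su] := ltP u s.
    by rewrite (ltW us)/= adde0 lee_fin Fk// u0.
  case: ifP => _; rewrite ?add0e lee_fin; last by rewrite FG// su.
  by rewrite (le_trans (FG u _)) ?su// lerDr.
rewrite ge0_integralD//=; first last.
- apply/(measurable_restrict (EFin \o G)) => //.
  by apply/measurable_EFinP; exact: measurable_funS mG.
- by move=> u _; rewrite /f2 /patch; case: ifP => // _; rewrite lee_fin.
- apply/(measurable_restrict (EFin \o cst k)) => //.
  by apply/measurable_EFinP; exact: measurable_cst.
- by move=> u _; rewrite /f1 /patch; case: ifP => // _; rewrite lee_fin.
rewrite -!integral_mkcondr EFinD leeD//.
  rewrite setIidr; last by apply: subset_itvl; rewrite bnd_simp.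
  have -> : (\int[mu]_(x in `[0%R, s]) (EFin \o cst k) x = k%:E * mu `[0%R, s]%classic)%E.
    exact: (@integral_cst _ _ R mu _ (measurable_itv _) k%:E).
  rewrite lebesgue_measure_itv/= lte_fin; case: ifPn => [_|].
    by rewrite oppr0 adde0 EFinM.
  by rewrite -leNgt => s0'; rewrite mule0 lee_fin mulr_ge0.
rewrite setIidr; last by apply: subset_itvr; rewrite bnd_simp.
rewrite /Rintegral fineK//; apply: integrable_fin_num => //.
exact: integrable_continuous_itv.
Qed.

Lemma within_continuousP (A : set R) (f : R -> R) t (e : R) : {within A, continuous f} ->
  A t -> 0 < e -> exists d, 0 < d /\ forall s, A s -> `|s - t| < d -> `|f s - f t| < e.
Proof.
move=> /subspace_continuousP cf At e0; have := cf t At.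
move=> /cvgrPdist_lt/(_ e e0); rewrite near_withinE => /nbhs_ballP[d/= d0 Hd].
exists d; split => // s As st; rewrite distrC; apply: Hd => //.
by rewrite /ball/= distrC.
Qed.

(** [s] is the last contact time before [tau], or [0] if there is none. In the first case
    [phi s = beta]; in the second [eta2] has no initial jump, so [phi 0 = w 0]. *)
Lemma skorohod_last_contact (beta tau : R) (w phi : R -> R) (eta1 eta2 : cumulative R R) :
  is_skorohod 0 beta w phi eta1 eta2 -> {within `[0, +oo[, continuous w} ->
  w 0 <= beta -> 0 <= tau -> (forall t, 0 <= t <= tau -> phi t = w t - eta2 t) ->
  exists s, [/\ 0 <= s <= tau, w 0 <= phi s & forall t, s <= t <= tau -> eta2 t = eta2 s].
Proof.
move=> sk cw wb tau0 phiE; have [_ _ phi_itv _ _] := sk.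
have phib t : 0 <= t -> phi t != beta -> phi t < beta.
  by move=> /phi_itv; rewrite in_itv/= => /andP[_ le] ne; rewrite lt_neqAle ne.
pose S := [set t | 0 <= t <= tau /\ phi t = beta].
have [S0|/set0P] := eqVneq S set0.
  have Sb t : 0 <= t <= tau -> phi t < beta.
    move=> ttau; apply: phib; first by case/andP: ttau.
    by apply/eqP => pb; have : S t by []; rewrite S0.
  exists 0; rewrite lexx tau0; split => //.
    by rewrite phiE ?lexx// (skorohod_initial sk) ?subr0// Sb ?lexx.
  move=> t /andP[t0 tt]; apply: (skorohod_flat sk) => // u /andP[u0 ut].
  by apply: Sb; rewrite (ltW u0) (le_trans ut).
move=> Sn0; have hS : has_sup S by split => //; exists tau => u [/andP[]].
pose s := sup S.
have s0 : 0 <= s by case: Sn0 => u Su; apply: le_trans (sup_upper_bound hS Su);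
  case: Su => /andP[].
have st : s <= tau by apply: ge_sup => // u [/andP[]].
(* The supremum of the contact times is itself one: if [phi s < beta], then [w] and [eta2] both vary
   by less than half the gap just before [s], which leaves no room for contacts accumulating
   there. *)
have phis : phi s = beta.
  apply/eqP/negPn/negP => /(phib _ s0) sb.
  pose e := (beta - phi s) / 2.
  have e0 : 0 < e by rewrite divr_gt0// subr_gt0.
  have [d1 [d10 H1]] := skorohod_left_continuous sk s0 sb e0.
  have As : `[0, +oo[%classic s by rewrite /= in_itv/= s0.
  have [d2 [d20 H2]] := within_continuousP cw As e0.
  have d0 : 0 < Num.min d1 d2 by rewrite lt_min d10.
  have [u Su us] := sup_adherent d0 hS.
  have [/andP[u0 ut] ub] := Su.
  have ules : u <= s by exact: sup_upper_bound.
  have us1 : s - d1 < u by apply: le_lt_trans us; rewrite lerD2l lerN2 ge_min lexx.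
  have us2 : s - d2 < u by apply: le_lt_trans us; rewrite lerD2l lerN2 ge_min lexx orbT.
  have h1 : eta2 s - eta2 u < e by apply: H1; rewrite ules ltW.
  have h2 : `|w u - w s| < e.
    by apply: H2; [rewrite /= in_itv/= u0|rewrite ler0_norm ?subr_le0//; lra].
  move: ub h2; rewrite phiE ?u0// ltr_norml => ub /andP[_ h2].
  have := phiE s; rewrite s0 st => /(_ isT) phisE.
  by move: h1 h2 ub phisE; rewrite /e; lra.
exists s; rewrite s0 st phis; split => // t /andP[ss tt].
apply: (skorohod_flat sk) => // u /andP[su ut].
have u0 : 0 <= u by rewrite (le_trans s0)// ltW.
apply: phib => //; apply/eqP => ub.
have : S u by split => //; rewrite u0 (le_trans ut).
by move=> /(sup_upper_bound hS); rewrite leNgt su.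
Qed.

(** The dynamics is right-continuous: a nonzero value at the infimum would exclude zeros immediately
    after it. *)
Lemma hitting_time_attained (y x : R) (psi : path2 R) (rho : R -> R) :
  continuous_path2 psi -> control_path rho -> (hitting_time y x psi rho < +oo)%E ->
  exists tau, [/\ 0 <= tau, hitting_time y x psi rho = tau%:E &
    dynamics y x psi rho tau = 0].
Proof.
move=> [[c1 _] [c2 _]] [_ _ [rc _]] fin.
set Z := [set t%:E | t in [set t : R | 0 <= t /\ dynamics y x psi rho t = 0]].
have H0 : (0 <= hitting_time y x psi rho)%E.
  by apply: le_ereal_inf_tmp => _ [t [t0 _] <-]; rewrite lee_fin.
have := fin; rewrite -ge0_fin_numE// => /fineK.
set tau := fine _ => tauE; exists tau; split => //.
  by rewrite -lee_fin tauE.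
have tau0 : 0 <= tau by rewrite -lee_fin tauE.
have rcd : dynamics y x psi rho t @[t --> tau^'+] --> dynamics y x psi rho tau.
  have rcpsi (f : R -> R) : {within `[0, +oo[, continuous f} -> f t @[t --> tau^'+] -->
    f tau.
    move=> /within_continuousP H; apply/cvgrPdist_lt => e e0.
    have [|d [d0 Hd]] := H tau e _ e0; first by rewrite /= in_itv/= tau0.
    near=> t; have tt : tau < t by near: t; exact: nbhs_right_gt.
    rewrite distrC; apply: Hd; first by rewrite /= in_itv/= (le_trans tau0) ?ltW.
    have : t < tau + d by near: t; apply: nbhs_right_lt; rewrite ltrDl.
    by rewrite gtr0_norm; lra.
  rewrite /dynamics; apply: cvgB; last exact: rc.
  apply: cvgB; last exact: rcpsi.
  apply: cvgD; last exact: rcpsi.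
  apply: cvgD; first exact: cvg_cst.
  by apply: cvgM; [exact: cvg_cst|apply: cvg_within_filter; exact: cvg_id].
apply/eqP/negPn/negP => nz.
have /cvgrPdist_lt/(_ `|dynamics y x psi rho tau|) := rcd.
rewrite normr_gt0 => /(_ nz) near_nz.
have [d /= d0 Hd] := near_nz.
have [_ [t [t0 dt] <-]] : exists2 z, Z z & (z < (tau + d)%:E)%E.
  by apply: ereal_inf_lt; rewrite -/(hitting_time _ _ _ _) -tauE lte_fin ltrDl.
rewrite lte_fin => ttd.
have taut : tau <= t by rewrite -lee_fin tauE; apply: ereal_inf_lbound; exists t.
move: taut; rewrite le_eqVlt => /predU1P[tt|tt]; first by rewrite tt dt eqxx in nz.
have := Hd t; rewrite /ball_/= => /(_ _ tt); rewrite dt subr0 ltxx => H.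
by have : false by apply: H; rewrite ltr0_norm; lra.
Unshelve. all: by end_near. Qed.

End Preliminaries.

(** * Integrals and increments of piecewise defined functions *)

Section Pieces.
Context {R : realType}.
Notation mu := (@lebesgue_measure R).

Lemma abs_continuous_lipschitz (a b K : R) (f : R -> R) :
  (forall s t, a <= s -> s <= t -> t <= b -> `|f t - f s| <= K * (t - s)) ->
  abs_continuous a b f.
Proof.
move=> lip e e0; have K0 : 0 < `|K| + 1 by rewrite ltr_wpDl.
exists (e / (`|K| + 1)); split; first by rewrite divr_gt0.
move=> n u v uv _; rewrite ltr_pdivlMr// => sd; apply: le_lt_trans sd.
rewrite mulr_suml; apply: ler_sum => i _; have [au uvi vb] := uv i.
apply: le_trans (lip _ _ au uvi vb) _.
by rewrite mulrC ler_wpM2l ?subr_ge0// (le_trans (ler_norm K))// lerDl.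
Qed.

Lemma increment_le_cells (F : R -> R) (k eps : R) (N : nat) : 0 <= eps ->
  (forall n s t, (n < N)%N -> n%:R * eps <= s -> s <= t -> t <= n.+1%:R * eps ->
    F t - F s <= k * (t - s)) ->
  forall s t, 0 <= s -> s <= t -> t <= N%:R * eps -> F t - F s <= k * (t - s).
Proof.
move=> eps0; elim: N => [|N IH] HF s t s0 st tN.
  have -> : t = s by move: tN; rewrite mul0r; lra.
  by rewrite !subrr mulr0.
have {}IH := IH (fun n s t nN => HF n s t (ltn_trans nN (ltnSn N))).
have [tN'|/ltW Nt] := leP t (N%:R * eps); first exact: IH.
have [/ltW sN|Ns] := ltP s (N%:R * eps); last exact: HF tN.
have h1 := IH s (N%:R * eps) s0 sN (lexx _).
have h2 := HF N (N%:R * eps) t (ltnSn N) (lexx _) Nt tN.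
lra.
Qed.

(** The integrand is prescribed only on the open interval, since the derivative of a piecewise path
    is uncontrolled at the junctions. Measurability on the longer interval is returned so that
    pieces can be appended repeatedly. *)
Lemma integral_append_continuous (e k : R -> R) (a t S : R) : 0 <= a -> a <= t ->
  (forall u, 0 <= e u) -> measurable_fun `[0, a] e ->
  (\int[mu]_(u in `[0%R, a]) (e u)%:E = S%:E)%E -> continuous k ->
  (forall u, a < u < t -> e u = k u) ->
  measurable_fun `[0, t] e /\
  (\int[mu]_(u in `[0%R, t]) (e u)%:E = (S + \int[mu]_(u in `[a, t]) k u)%:E)%E.
Proof.
move=> a0; rewrite le_eqVlt => /predU1P[<-|at_] e0 me eS ck ek.
  by rewrite set_itv1 Rintegral_set1 addr0.
have moo : measurable_fun `]a, t[ e.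
  apply: (eq_measurable_fun k);
    last exact: measurable_funS (continuous_measurable_fun ck).
  by move=> u; rewrite inE/= in_itv/= => /ek ->.
have moc : measurable_fun `]a, t] e by exact/measurable_fun_itv_bndo_bndcP.
have E : `[0, t]%classic = `[0, a]%classic `|` `]a, t]%classic.
  by rewrite -itv_bndbnd_setU// bnd_simp ?ltW.
have m0t : measurable_fun `[0, t] e by rewrite E; apply/measurable_funU.
split => //; rewrite E ge0_integral_setU//=; first last.
- apply: lt_disjoint => u v /=; rewrite !in_itv/= => /andP[_ ua] /andP[av _].
  exact: le_lt_trans av.
- by move=> u _; rewrite lee_fin.
- by rewrite -E; exact/measurable_EFinP.
rewrite eS -integral_itv_bndo_bndc//; last exact/measurable_EFinP.
rewrite EFinD; congr (_ + _)%E.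
under eq_integral => u do [rewrite inE/= in_itv/= => /ek ->].
have mk (i : interval R) : measurable_fun [set` i] (EFin \o k).
  by apply/measurable_EFinP; exact: measurable_funS (continuous_measurable_fun ck).
rewrite (integral_itv_bndo_bndc (f := EFin \o k))// (integral_itv_obnd_cbnd (f := EFin \o k))//.
by rewrite /Rintegral fineK//; apply: integrable_fin_num => //;
  exact: integrable_continuous_itv.
Qed.

Lemma integral_append_constant (e : R -> R) (a t k S : R) : 0 <= a -> a <= t ->
  (forall u, 0 <= e u) -> measurable_fun `[0, a] e ->
  (\int[mu]_(u in `[0%R, a]) (e u)%:E = S%:E)%E -> (forall u, a < u < t -> e u = k) ->
  measurable_fun `[0, t] e /\
  (\int[mu]_(u in `[0%R, t]) (e u)%:E = (S + k * (t - a))%:E)%E.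
Proof.
move=> a0 at_ e0 me eS ek.
have [|mt ->] := @integral_append_continuous e (cst k) a t S a0 at_ e0 me eS _ ek.
  by move=> u; exact: cvg_cst.
split => //; rewrite Rintegral_cst//= lebesgue_measure_itv/= lte_fin; case: ltP => //= ta.
have -> : a = t by lra.
by rewrite subrr.
Qed.

Lemma constant_of_zero_derive (K : R -> R) (a b : R) : continuous K ->
  (forall t, a < t < b -> is_derive t 1 K 0) -> forall t, a <= t <= b -> K t = K a.
Proof.
move=> cK dK t /andP[at_ tb].
have [u|_ _] := MVT_segment at_ (df := fun=> 0) _ (continuous_subspaceT cK).
  by rewrite in_itv/= => /andP[au ut]; apply: dK; rewrite au (lt_le_trans ut).
by rewrite mul0r => /eqP; rewrite subr_eq0 => /eqP.
Qed.

End Pieces.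

Lemma clamp_continuous {R : realType} (a b : R) : continuous (clamp a b).
Proof.
move=> u; apply/cvgrPdist_lt => e e0; near=> t.
apply: (@le_lt_trans _ _ `|u - t|); last by near: t; apply/nbhs_ballP; exists e.
have [st|/ltW ts] := leP u t.
  by rewrite distrC (distrC u) !ger0_norm ?subr_ge0 ?clamp_lip//; exact: clamp_homo.
by rewrite !ger0_norm ?subr_ge0 ?clamp_lip//; exact: clamp_homo.
Unshelve. all: by end_near. Qed.

Lemma continuous_comp_clamp {R : realType} (a b : R) (f : R -> R) : a <= b ->
  {within `[a, b], continuous f} -> continuous (f \o clamp a b).
Proof.
move=> ab /subspace_continuousP cf u.
have clu v : `[a, b]%classic (clamp a b v) by rewrite /= in_itv/= clamp_itv.
apply: cvg_comp (cf _ (clu u)) => P nP.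
have H := @clamp_continuous R a b u (fun z => `[a, b]%classic z -> P z) nP.
suff : \forall t \near u, P (clamp a b t) by [].
near=> t; have : `[a, b]%classic (clamp a b t) -> P (clamp a b t) by near: t; exact: H.
exact.
Unshelve. all: by end_near. Qed.

(** * The candidate value function *)

Section ValueFunction.
Context {R : realType}.
Variables (D r c1 c2 y : R) (h : R -> R).
Hypotheses (D_gt0 : 0 < D) (r_gt0 : 0 < r) (c1_gt0 : 0 < c1) (c2_gt0 : 0 < c2).
Hypothesis h_cont : {within `[0, D], continuous h}.
Hypothesis h_incr : {in `[0, D] &, {homo h : u v / u < v}}.
Hypothesis h_0 : h 0 = 0.
Hypothesis y_le : r / (4 * ceff c1 c2) <= - y.
Notation c := (ceff c1 c2).
Notation beta := (beta0 D r c1 c2 y h).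

Lemma h_ndecr u v : 0 <= u -> u <= v -> v <= D -> h u <= h v.
Proof.
move=> u0; rewrite le_eqVlt => /predU1P[->//|uv] vD.
by apply/ltW/h_incr; rewrite ?in_itv/= ?u0 ?vD ?andbT//= ?(le_trans (ltW uv))// (le_trans u0)// ltW.
Qed.

Lemma neg_y_gt0 : 0 < - y.
Proof. by apply: lt_le_trans y_le; rewrite divr_gt0// mulr_gt0// ceff_gt0. Qed.

Lemma beta_spec : 0 <= beta <= D /\ h beta <= r * (- y) - r ^+ 2 / (4 * c).
Proof.
have c0 := ceff_gt0 c1_gt0 c2_gt0.
rewrite /beta0; case: ifPn => [hD|]; last first.
  by rewrite -ltNge lexx (ltW D_gt0) => hD; split => //; lra.
(* The level at which [h] is inverted factors as [r * (- y - r / (4 * c))], so [y_le] makes it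
   nonnegative; the intermediate value theorem then ensures that [hinv] does not take its default
   value. *)
have v0 : 0 <= - (r ^+ 2 / (4 * c)) - r * y.
  have -> : - (r ^+ 2 / (4 * c)) - r * y = r * (- y - r / (4 * c)).
    by field; rewrite gt_eqF.
  by rewrite mulr_ge0 ?subr_ge0// ltW.
rewrite /hinv; case: xgetP => [u _ [] + ->|].
  by rewrite in_itv/= => ->; split => //; lra.
have [|u uD hu] := IVT (ltW D_gt0) h_cont (v := - (r ^+ 2 / (4 * c)) - r * y); last first.
  by move=> /(_ u) []; split.
have hD0 : 0 <= h D by rewrite -h_0 h_ndecr// ltW.
by rewrite h_0 min_l// max_r// v0/=; lra.
Qed.

(* h is frozen outside [0, beta], which makes all functions below total and continuous;
   [optimal_rate] vanishes on the negative half-line. *)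
Definition clamped_cost u := h (clamp 0 beta u).
Definition optimal_rate u := - y - Num.sqrt (y ^+ 2 - clamped_cost u / c).
Definition value_fun := oriented_integral (fun u => 2 * c * optimal_rate u).

Let c0 := ceff_gt0 c1_gt0 c2_gt0.

Lemma clamp_beta_itv u : 0 <= clamp 0 beta u <= beta.
Proof. by apply: clamp_itv; have [/andP[]] := beta_spec. Qed.

Lemma clamped_cost_id u : 0 <= u <= beta -> clamped_cost u = h u.
Proof. by move=> u0; rewrite /clamped_cost clamp_id. Qed.

Lemma clamped_cost_ndecr : {homo clamped_cost : u v / u <= v}.
Proof.
move=> u v uv; have [/andP[_ bD] _] := beta_spec.
have /andP[u0 _] := clamp_beta_itv u; have /andP[_ vb] := clamp_beta_itv v.
by apply: h_ndecr => //; [exact: clamp_homo|exact: le_trans bD].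
Qed.

Lemma clamped_cost_itv u : 0 <= clamped_cost u <= h beta.
Proof.
have [/andP[b0 bD] _] := beta_spec; have /andP[u0 ub] := clamp_beta_itv u.
by rewrite -{1}h_0 !h_ndecr//; exact: le_trans bD.
Qed.

Lemma clamped_cost_continuous : continuous clamped_cost.
Proof.
have [/andP[b0 bD] _] := beta_spec.
apply: continuous_comp_clamp => //; apply: continuous_subspaceW h_cont.
exact: subset_itvScc.
Qed.

Lemma clamped_cost_le0 u : u <= 0 -> clamped_cost u = 0.
Proof.
have [/andP[b0 bD] _] := beta_spec.
by move=> u0; rewrite /clamped_cost /clamp min_l ?(le_trans u0)// max_l.
Qed.

(** This is the inequality of [beta_spec] with the square completed. It makes the root in
    [optimal_rate] genuine and, after taking roots, gives [marginal_value_le]. *)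
Lemma discriminant_ge u : (- y - r / (2 * c)) ^+ 2 <= y ^+ 2 - clamped_cost u / c.
Proof.
have [_ hb] := beta_spec; have /andP[_ ub] := clamped_cost_itv u.
rewrite -subr_ge0.
have -> : y ^+ 2 - clamped_cost u / c - (- y - r / (2 * c)) ^+ 2 =
   (r * (- y) - r ^+ 2 / (4 * c) - clamped_cost u) / c.
  by field; rewrite gt_eqF.
by rewrite divr_ge0 ?(ltW c0)// subr_ge0 (le_trans ub).
Qed.

Lemma discriminant_ge0 u : 0 <= y ^+ 2 - clamped_cost u / c.
Proof. exact: le_trans (sqr_ge0 _) (discriminant_ge u). Qed.

Lemma optimal_rate_itv u : 0 <= optimal_rate u <= - y.
Proof.
have y0 := neg_y_gt0.
rewrite /optimal_rate lerBlDr lerDl sqrtr_ge0 andbT subr_ge0.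
rewrite -[leRHS]ger0_norm ?(ltW y0)// normrN -sqrtr_sqr ler_wsqrtr//.
rewrite lerBlDr lerDl divr_ge0 ?(ltW c0)//.
by have /andP[] := clamped_cost_itv u.
Qed.

Lemma optimal_rate_ndecr : {homo optimal_rate : u v / u <= v}.
Proof.
move=> u v uv; rewrite /optimal_rate lerD2l lerN2; apply: ler_wsqrtr.
rewrite lerD2l lerN2; apply: ler_wpM2r; first by rewrite invr_ge0 ltW.
exact: clamped_cost_ndecr.
Qed.

Lemma optimal_rate_continuous : continuous optimal_rate.
Proof.
move=> u; apply: cvgB; first exact: cvg_cst.
apply: (@continuous_comp _ _ _ (fun v => y ^+ 2 - clamped_cost v / c) Num.sqrt);
  last exact: sqrt_continuous.
apply: cvgB; first exact: cvg_cst.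
by apply: cvgM; [exact: clamped_cost_continuous|exact: cvg_cst].
Qed.

Lemma optimal_rate_le0 u : u <= 0 -> optimal_rate u = 0.
Proof.
move=> u0; rewrite /optimal_rate clamped_cost_le0// mul0r subr0 sqrtr_sqr.
by rewrite -normrN ger0_norm ?subrr// ltW// neg_y_gt0.
Qed.

(** [optimal_rate u] is the smaller root [v] of [c * v ^+ 2 + 2 * c * y * v + clamped_cost u =
    0]. *)
Lemma hamilton_jacobi u :
  clamped_cost u = 2 * c * optimal_rate u * (- y) - c * optimal_rate u ^+ 2.
Proof.
have := sqr_sqrtr (discriminant_ge0 u); rewrite /optimal_rate.
set s := Num.sqrt _ => sE.
have -> : clamped_cost u = c * (y ^+ 2 - s ^+ 2) by rewrite sE; field; rewrite gt_eqF.
ring.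
Qed.

Lemma marginal_value_le u : 2 * c * optimal_rate u <= r.
Proof.
(* Since only [r / (4 * c) <= - y] is assumed, [- y - r / (2 * c)] may be negative; hence the
   absolute value. *)
have s0 : `|- y - r / (2 * c)| <= Num.sqrt (y ^+ 2 - clamped_cost u / c).
  by rewrite -sqrtr_sqr ler_wsqrtr// discriminant_ge.
have le : - y - r / (2 * c) <= `|- y - r / (2 * c)| by exact: ler_norm.
have : optimal_rate u <= r / (2 * c) by rewrite /optimal_rate; lra.
by rewrite ler_pdivlMr ?mulr_gt0// mulrC.
Qed.

Lemma value_fun_derive (u : R) : is_derive u 1 value_fun (2 * c * optimal_rate u).
Proof.
apply: oriented_integral_derive => v; apply: cvgM; first exact: cvg_cst.
exact: optimal_rate_continuous.
Qed.

Lemma value_fun0 : value_fun 0 = 0.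
Proof. by rewrite /value_fun /oriented_integral lexx set_itv1 Rintegral_set1. Qed.

(** The derivative is monotone, so the tangent at [u] lies below the graph on both sides. This
    inequality bounds increments of the value along paths that are not differentiable. *)
Lemma value_fun_convex u v :
  value_fun u - value_fun v <= 2 * c * optimal_rate u * (u - v).
Proof.
have mono s t : s <= t -> 2 * c * optimal_rate s <= 2 * c * optimal_rate t.
  by move=> st; rewrite ler_wpM2l ?mulr_ge0 ?(ltW c0)//; exact: optimal_rate_ndecr.
have [uv|vu] := leP u v.
  have [w /andP[uw _] E] := mean_value value_fun_derive uv.
  rewrite -subr_ge0 -(opprB (value_fun v)) E.
  have -> : 2 * c * optimal_rate u * (u - v) - - (2 * c * optimal_rate w * (v - u)) =
    (2 * c * optimal_rate w - 2 * c * optimal_rate u) * (v - u) by ring.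
  by rewrite mulr_ge0 ?subr_ge0 ?mono.
have [w /andP[_ wu] ->] := mean_value value_fun_derive (ltW vu).
by rewrite ler_wpM2r ?subr_ge0 ?mono// ltW.
Qed.

Lemma value_fun_ndecr : {homo value_fun : u v / u <= v}.
Proof.
move=> u v uv; rewrite -subr_le0 (le_trans (value_fun_convex u v))//.
rewrite mulr_ge0_le0 ?subr_le0// mulr_ge0 ?mulr_ge0 ?(ltW c0)//.
by have /andP[] := optimal_rate_itv u.
Qed.

Lemma value_fun_lip u v : v <= u -> value_fun u - value_fun v <= r * (u - v).
Proof.
move=> vu; apply: le_trans (value_fun_convex u v) _.
by rewrite ler_wpM2r ?subr_ge0// marginal_value_le.
Qed.

(** * Barrier strategies cost at most the candidate value *)

(* s is the last time at which the state touches the barrier.  Up to s, Young's bound with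
   k = r / (2 * c) and h <= - r * y - r ^+ 2 / (4 * c) bound the cost by r * (x - state at s);
   after s nothing is pushed and k = optimal_rate (state) is the Hamilton-Jacobi bound. *)
Lemma contact_cost_le (x tau s : R) (psi : path2 R) (rho : R -> R) :
  continuous_path2 psi -> 0 <= s -> s <= tau ->
  (forall t, 0 <= t <= tau -> 0 <= dynamics y x psi rho t <= beta) ->
  dynamics y x psi rho tau = 0 -> x <= dynamics y x psi rho s ->
  (forall t, s <= t <= tau -> rho t = rho s) ->
  (\int[lebesgue_measure]_(t in `[0%R, tau]) (h (dynamics y x psi rho t))%:E
    + (r * rho tau)%:E - path_cost c1 c2 tau psi <= (value_fun x)%:E)%E.
Proof.
move=> [[cpsi1 psi10] [cpsi2 psi20]] s0 st dyn_itv dyn_tau x_dyn rho_cst.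
have tau0 : 0 <= tau by exact: le_trans st.
have [/andP[b0 bD] hb] := beta_spec.
have hb0 : 0 <= h beta by have /andP[] := clamped_cost_itv 0; exact: le_trans.
have [[ac1 ac2]|nac] := pselect (abs_continuous 0 tau psi.1 /\ abs_continuous 0 tau psi.2); last first.
  by rewrite /path_cost asboolF//= addeNy leNye.
have [->|[E [E0 EJ EE]]] := path_cost_minorant c1_gt0 c2_gt0 tau0 ac1 ac2.
  by rewrite addeNy leNye.
(* With the push frozen at [rho s], [W] is continuous and agrees with the state on [[s, tau]]. *)
pose W t := x + y * t + psi.1 t - psi.2 t - rho s.
have WE t : s <= t <= tau -> W t = dynamics y x psi rho t.
  by move=> stt; rewrite /W /dynamics rho_cst.
pose G t := clamped_cost (W (clamp s tau t)).
have GE t : s <= t <= tau -> G t = clamped_cost (W t) by move=> stt; rewrite /G clamp_id.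
have sub : `[s, tau] `<=` `[0, +oo[.
  by move=> t /=; rewrite !in_itv/= andbT => /andP[st' _]; exact: le_trans st'.
have cG : continuous G.
  have cW : continuous (W \o clamp s tau).
    apply: continuous_comp_clamp => // t.
    apply: cvgB; last exact: cvg_cst.
    apply: cvgB; last exact: (continuous_subspaceW sub cpsi2).
    apply: cvgD; last exact: (continuous_subspaceW sub cpsi1).
    apply: cvgD; first exact: cvg_cst.
    apply: cvgM; first exact: cvg_cst.
    by apply: (@continuous_subspaceT _ _ _ id) => // ?; exact: cvg_id.
  by move=> t; apply: (@continuous_comp _ _ _ (W \o clamp s tau) clamped_cost);
    [exact: cW|exact: clamped_cost_continuous].
have G0 t : 0 <= G t by have /andP[] := clamped_cost_itv (W (clamp s tau t)).
pose J := oriented_integral G.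
have dJ (t : R) : is_derive t 1 J (G t) by exact: oriented_integral_derive.
have main : J tau - E tau + value_fun (W tau) <= J s - E s + value_fun (W s).
  apply: (@local_upper_slope_le0 _ (fun t => J t - E t + value_fun (W t))) =>
    // k v k0 /andP[sv vt].
  have k20 : 0 < k / 2 by rewrite divr_gt0.
  have /cvgrPdist_lt/(_ _ k20)/nbhs_ballP[d /= d0 Hd] := cG v.
  exists d; split => // p q sp pq qt dp dq.
  have Gd u : p <= u <= q -> `|G v - G u| < k / 2.
    by move=> /andP[pu uq]; apply: Hd; rewrite /ball/= ltr_norml; lra.
  have [u upq Ju] := mean_value dJ pq.
  have := Gd u upq; have := Gd q; rewrite pq lexx => /(_ isT).
  rewrite !ltr_norml => /andP[Gq1 Gq2] /andP[Gu1 Gu2].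
  have sq : s <= q <= tau by rewrite qt (le_trans sp).
  (* Young's bound and the tangent inequality are both taken at the right end [q]. By the
     Hamilton-Jacobi equation everything cancels except [(G u - G q) * (q - p)], which continuity of
     [G] makes small. *)
  have := EE (optimal_rate (W q)) p q (le_trans s0 sp) pq qt.
  have := value_fun_convex (W q) (W p).
  have := hamilton_jacobi (W q); rewrite -GE// => HJ.
  have Wqp : W q - W p = y * (q - p) + (psi.1 q - psi.2 q - (psi.1 p - psi.2 p)).
    by rewrite /W; ring.
  rewrite Wqp; set om := _ - _ - (_ - _); set f := optimal_rate _ in HJ *.
  have : (G u - G q) * (q - p) <= k * (q - p).
    by rewrite ler_wpM2r ?subr_ge0//; lra.
  have : G q * (q - p) = (2 * c * f * (- y) - c * f ^+ 2) * (q - p) by rewrite HJ.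
  lra.
have cost_le : (\int[lebesgue_measure]_(t in `[0%R, tau]) (h (dynamics y x psi rho t))%:E
    <= (h beta * s + (J tau - J s))%:E)%E.
  rewrite /J oriented_integralB//; apply: ge0_integral_two_pieces_le => // u.
  - move=> /dyn_itv /andP[d0 db]; rewrite -h_0; apply: h_ndecr => //; exact: le_trans bD.
  - move=> /andP[u0 us]; have /andP[d0 db] : 0 <= dynamics y x psi rho u <= beta.
      by apply: dyn_itv; rewrite u0 ltW// (lt_le_trans us).
    exact: h_ndecr.
  - move=> /[dup] su /andP[s1 s2]; rewrite GE// WE// clamped_cost_id//.
    by apply: dyn_itv; rewrite s2 (le_trans s0).
apply: (@le_trans _ _ ((h beta * s + (J tau - J s)) + r * rho tau - E tau)%:E)%E.
  rewrite EFinB EFinD; apply: leeB => //; exact: leeD2r.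
rewrite lee_fin.
have := EE (r / (2 * c)) 0 s (lexx 0) s0 st.
rewrite E0 psi10 psi20 !subr0.
have -> : 2 * c * (r / (2 * c)) = r by field; rewrite gt_eqF.
have -> : c * (r / (2 * c)) ^+ 2 = r ^+ 2 / (4 * c) by field; rewrite gt_eqF.
move: main; rewrite !WE ?lexx ?st// dyn_tau value_fun0 => main.
have := value_fun_lip x_dyn.
have : h beta * s <= (r * - y - r ^+ 2 / (4 * c)) * s by exact: ler_wpM2r.
rewrite (rho_cst tau) ?lexx ?st//; move: main.
have : r * dynamics y x psi rho s = r * (x + y * s + psi.1 s - psi.2 s - rho s) by [].
set d := dynamics _ _ _ _ _; set q := r ^+ 2 / (4 * c).
lra.
Qed.


Lemma barrier_cost_le (x : R) (alpha : strategy R) (psi : path2 R) : 0 <= x <= beta ->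
  barrier_strategy D y x beta alpha -> terminating y x alpha psi ->
  (cost r c1 c2 y h x psi (alpha psi) <= (value_fun x)%:E)%E.
Proof.
move=> /andP[x0 xb] [_ _ [[ctrl _] _] bar] tpsi.
have [cpsi fin] := tpsi.
have [tau [tau0 tauE dyn_tau]] := hitting_time_attained cpsi (ctrl _ cpsi) fin.
have [[cpsi1 psi10] [cpsi2 psi20]] := cpsi.
rewrite /cost tauE /=.
have := bar psi tpsi; case: eqP => [b0 a0|_ [phi [eta1 [eta2 [sk skE]]]]].
  have x_eq : x = 0 by lra.
  have dyn0 : dynamics y x psi (alpha psi) 0 = 0.
    by rewrite /dynamics a0 psi10 psi20 mulr0 !addr0 subr0 subrr.
  have tau_eq : tau = 0.
    apply/eqP; rewrite eq_le tau0 andbT -lee_fin -tauE.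
    by apply: ereal_inf_lbound; exists 0.
  rewrite tau_eq in dyn_tau *.
  apply: (@contact_cost_le x 0 0) => //.
  - move=> t /andP[? ?]; have -> : t = 0 by lra.
    by rewrite dyn0 b0 lexx.
  - by rewrite dyn0 x_eq.
  - by move=> t /andP[? ?]; have -> : t = 0 by lra.
have phiE t : 0 <= t <= tau -> [/\ dynamics y x psi (alpha psi) t = phi t, eta1 t = 0
    & alpha psi t = eta2 t].
  by move=> /andP[t0 tt]; apply: skE => //; rewrite tauE lee_fin.
have w0 : x + y * 0 + psi.1 0 - psi.2 0 = x by rewrite psi10 psi20 mulr0 !addr0 subr0.
have [_ phi_w phi_itv _ _] := sk.
have [||t ttau|s [/andP[s0 st] xs rho_cst]] := skorohod_last_contact sk _ _ tau0.
- move=> t; apply: cvgB; last exact: cpsi2.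
  apply: cvgD; last exact: cpsi1.
  apply: cvgD; first exact: cvg_cst.
  apply: cvgM; first exact: cvg_cst.
  by apply: (@continuous_subspaceT _ _ _ id) => // ?; exact: cvg_id.
- by rewrite w0.
- have [_ eta10 _] := phiE t ttau; have /andP[t0 _] := ttau.
  by rewrite phi_w// eta10 addr0.
have sE : 0 <= s <= tau by rewrite s0.
apply: (@contact_cost_le x tau s) => //.
- move=> t ttau; have [-> _ _] := phiE t ttau.
  by have /andP[/phi_itv + _] := ttau; rewrite in_itv.
- by have [-> _ _] := phiE s sE; rewrite w0 in xs.
- move=> t /[dup] /rho_cst eE /andP[s1 t1].
  have [_ _ ->] := phiE s sE.
  by have [|_ _ ->] := phiE t; first by rewrite t1 (le_trans s0).
Qed.

(** The split of a net displacement [w] between the two components for which [energy_young] is an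
    equality. *)
Definition effort (w : R -> R) : path2 R :=
  (fun t => c / c1 * w t, fun t => - (c / c2) * w t).

Lemma effortB w t : (effort w).1 t - (effort w).2 t = w t.
Proof. by rewrite /= mulNr opprK -mulrDl ceff_sum// mul1r. Qed.

Lemma effort_energy (psi : path2 R) (w : R -> R) (t l : R) :
  (\forall s \near t, psi.1 s = (effort w).1 s /\ psi.2 s = (effort w).2 s) ->
  is_derive t 1 w l ->
  c1 * (derive1 psi.1 t) ^+ 2 + c2 * (derive1 psi.2 t) ^+ 2 = c * l ^+ 2.
Proof.
move=> near_psi dw.
have D1 : derive1 psi.1 t = c / c1 * l.
  rewrite derive1E (@near_eq_derive R R R _ (effort w).1).
    exact: derive_val.
  by apply: filterS near_psi => s [].
have D2 : derive1 psi.2 t = - (c / c2) * l.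
  rewrite derive1E (@near_eq_derive R R R _ (effort w).2).
    exact: derive_val.
  by apply: filterS near_psi => s [].
rewrite D1 D2 -[in RHS](mulr1 c) -(ceff_sum c1_gt0 c2_gt0); field.
by rewrite (gt_eqF c1_gt0) (gt_eqF c2_gt0).
Qed.

Lemma effort_continuous_path (w : R -> R) : continuous_path w ->
  continuous_path2 (effort w).
Proof.
move=> [cw w0]; split; split; rewrite /= ?w0 ?mulr0//.
- by move=> t; apply: cvgM; [exact: cvg_cst|exact: cw].
- by move=> t; apply: cvgM; [exact: cvg_cst|exact: cw].
Qed.

(** * Every admissible strategy costs at least the candidate value *)

(* A strategy is only causal, so the feedback equation for the maximizer may have no
   solution; the feedback rate, slightly reduced to force termination, is sampled at the
   multiples of eps instead.  Convexity of the value function makes the sampling error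
   telescope. *)
Section SampledFeedback.
Variables (x : R) (alpha : strategy R) (eta eps : R).
Hypotheses (eps_gt0 : 0 < eps) (eta_gt0 : 0 < eta) (eta_lt1 : eta < 1).
Hypothesis x_itv : 0 <= x <= beta.
Hypothesis adm : admissible D y x alpha.

(** Stage [n] is frozen after time [n * eps]; this suffices to query the causal strategy at that
    time and to fix the speed on the next cell. *)
Fixpoint sampled n : R -> R :=
  match n with
  | 0 => fun=> 0
  | n.+1 => fun t => sampled n t + (1 - eta) *
      optimal_rate (dynamics y x (effort (sampled n)) (alpha (effort (sampled n))) (n%:R * eps)) *
      clamp 0 eps (t - n%:R * eps)
  end.

Lemma sampled_continuous n : continuous (sampled n).
Proof.
elim: n => [|n IH] t; first exact: cvg_cst.
apply: cvgD; first exact: IH.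
apply: cvgM; first exact: cvg_cst.
apply: (@continuous_comp _ _ _ (fun t => t - n%:R * eps) (clamp 0 eps)).
  by apply: cvgB; [exact: cvg_id|exact: cvg_cst].
exact: clamp_continuous.
Qed.

Lemma clamp_le0 t : t <= 0 -> clamp 0 eps t = 0.
Proof. by move=> t0; rewrite /clamp max_l// ge_min t0. Qed.

Lemma clamp_ge t : eps <= t -> clamp 0 eps t = eps.
Proof. by move=> t0; rewrite /clamp min_r// max_r// ltW. Qed.

Lemma sampled_before m n t : (n <= m)%N -> t <= n%:R * eps -> sampled m t = sampled n t.
Proof.
move=> /subnK <- tn; elim: (m - n)%N => [//|k IH].
rewrite addSn /= IH clamp_le0 ?mulr0 ?addr0// subr_le0 (le_trans tn)//.
by rewrite ler_wpM2r ?(ltW eps_gt0)// ler_nat leq_addl.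
Qed.

Lemma sampled_after n t : n%:R * eps <= t -> sampled n t = sampled n (n%:R * eps).
Proof.
elim: n t => [//|n IH] t nt /=.
have nS : n.+1%:R * eps = n%:R * eps + eps by rewrite -natr1 mulrDl mul1r.
have ht : n%:R * eps <= t by move: nt; rewrite nS; move: eps_gt0; lra.
have hn : n%:R * eps <= n.+1%:R * eps by rewrite nS lerDl ltW.
rewrite IH// [in RHS]IH// clamp_ge; last by move: nt; rewrite nS; lra.
by rewrite clamp_ge// nS; lra.
Qed.

Lemma sampled0 n : sampled n 0 = 0.
Proof. by rewrite (@sampled_before n 0)// mul0r. Qed.

Lemma sampled_path n : continuous_path2 (effort (sampled n)).
Proof.
apply: effort_continuous_path; split; last exact: sampled0.
exact/continuous_subspaceT/sampled_continuous.
Qed.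

Variable N : nat.
Let psi := effort (sampled N).
Let phi := dynamics y x psi (alpha psi).
Let speed n := (1 - eta) * optimal_rate (phi (n%:R * eps)).

Lemma sampled_cell n t : (n < N)%N -> n%:R * eps <= t -> t <= n.+1%:R * eps ->
  sampled N t = sampled N (n%:R * eps) + speed n * (t - n%:R * eps).
Proof.
move=> nN nt tn.
have nS : n.+1%:R * eps = n%:R * eps + eps by rewrite -natr1 mulrDl mul1r.
have ne0 : 0 <= n%:R * eps by rewrite mulr_ge0// ltW.
rewrite (@sampled_before N n.+1)// (@sampled_before N n (n%:R * eps))//; last exact: ltnW.
rewrite /= (sampled_after nt) clamp_id; last by move: tn; rewrite nS; lra.
congr (_ + _ * optimal_rate _ * _).
have agree s : s \in `[0, n%:R * eps] ->
    (effort (sampled n)).1 s = psi.1 s /\ (effort (sampled n)).2 s = psi.2 s.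
  by rewrite in_itv/= => /andP[_ sn];
    rewrite /psi /= !(@sampled_before N n s (ltnW nN) sn).
have [[_ causal] _] := adm.
have last : n%:R * eps \in `[0, n%:R * eps] by rewrite in_itv/= ne0 lexx.
rewrite /phi /dynamics (causal _ _ _ ne0 (sampled_path n) (sampled_path N) agree)//.
by rewrite (agree _ last).1 (agree _ last).2.
Qed.

Lemma speed_itv n : 0 <= speed n <= (1 - eta) * (- y).
Proof.
have /andP[f0 fb] := optimal_rate_itv (phi (n%:R * eps)).
have eta0 : 0 <= 1 - eta by rewrite subr_ge0 ltW.
by rewrite mulr_ge0//= ler_wpM2l.
Qed.

Lemma sampled_increment s t : 0 <= s -> s <= t -> t <= N%:R * eps ->
  0 <= sampled N t - sampled N s <= (1 - eta) * (- y) * (t - s).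
Proof.
move=> s0 st tN; apply/andP; split; last first.
  apply: (@increment_le_cells _ _ _ eps N (ltW eps_gt0)) => // n p q nN np pq qn.
  rewrite (sampled_cell nN (le_trans np pq) qn) (sampled_cell nN np (le_trans pq qn)).
  have /andP[_ sp] := speed_itv n.
  have : speed n * (q - p) <= (1 - eta) * (- y) * (q - p) by rewrite ler_wpM2r// subr_ge0.
  lra.
suff : - sampled N t - - sampled N s <= 0 * (t - s) by rewrite mul0r; lra.
apply: (@increment_le_cells _ (fun t => - sampled N t) _ eps N (ltW eps_gt0)) =>
  // n p q nN np pq qn.
rewrite (sampled_cell nN (le_trans np pq) qn) (sampled_cell nN np (le_trans pq qn)).
have /andP[sp _] := speed_itv n.
have : 0 <= speed n * (q - p) by rewrite mulr_ge0// subr_ge0.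
lra.
Qed.

Lemma control_increment s t : 0 <= s -> s <= t -> alpha psi s <= alpha psi t.
Proof. by have [[ctrl _] _] := adm; have [_ + _] := ctrl _ (sampled_path N); apply. Qed.

(** As [optimal_rate] never exceeds [- y], the factor [1 - eta] leaves a downward drift of at least
    [eta * (- y)], and the control only adds to it. *)
Lemma phi_increment s t : 0 <= s -> s <= t -> t <= N%:R * eps ->
  phi t - phi s <= - (eta * (- y) * (t - s)).
Proof.
move=> s0 st tN; have /andP[_ up] := sampled_increment s0 st tN.
have mono := control_increment s0 st.
have -> : phi t - phi s = y * (t - s) + (sampled N t - sampled N s)
    - (alpha psi t - alpha psi s).
  rewrite /phi /dynamics -!(effortB (sampled N)) -/psi; ring.
lra.
Qed.

Lemma phi_initial : phi 0 = x - alpha psi 0.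
Proof. by rewrite /phi /dynamics /psi /= sampled0 !mulr0 subr0 !addr0. Qed.

Lemma control_ge0 t : 0 <= t -> 0 <= alpha psi t.
Proof. by have [[ctrl _] _] := adm; have [+ _ _] := ctrl _ (sampled_path N); apply. Qed.

Hypothesis horizon : x < eta * (- y) * (N%:R * eps).

Lemma sampled_terminates : exists tau, [/\ 0 <= tau <= N%:R * eps,
  hitting_time y x psi (alpha psi) = tau%:E & phi tau = 0].
Proof.
have [[ctrl _] state] := adm.
have T0 : 0 <= N%:R * eps by rewrite mulr_ge0// ltW.
(* A game still running at [N * eps] would have a nonnegative state there by admissibility, against
   the drift and [horizon]. *)
have lt : (hitting_time y x psi (alpha psi) < (N%:R * eps)%:E)%E.
  rewrite ltNge; apply/negP => /(state psi (sampled_path N) _ T0).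
  rewrite in_itv/= -/phi => /andP[p0 _].
  have := phi_increment (lexx 0) T0 (lexx _).
  rewrite phi_initial subr0; have := control_ge0 (lexx 0); move: horizon p0; lra.
have [tau [tau0 tauE phit]] :=
  hitting_time_attained (sampled_path N) (ctrl _ (sampled_path N)) (lt_trans lt (ltry _)).
exists tau; split => //; rewrite tau0/= -lee_fin; apply/ltW.
by rewrite -tauE.
Qed.

Lemma sampled_derive n t : (n < N)%N -> n%:R * eps < t < n.+1%:R * eps ->
  c1 * (derive1 psi.1 t) ^+ 2 + c2 * (derive1 psi.2 t) ^+ 2 = c * speed n ^+ 2.
Proof.
move=> nN /andP[nt tn]; apply: (@effort_energy _ (sampled N)); first by exists 1;
  [exact: ltr01|move=> s _; split].
apply: (@near_eq_is_derive R R R (fun s =>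
  sampled N (n%:R * eps) + speed n * (s - n%:R * eps))).
  near=> s.
  have ns : n%:R * eps <= s by apply/ltW; near: s; exact: lt_nbhsr.
  have sn : s <= n.+1%:R * eps by apply/ltW; near: s; exact: lt_nbhsl.
  by rewrite [RHS](sampled_cell nN ns sn).
apply: is_derive_eq; rewrite /GRing.scale/=; ring.
Unshelve. all: by end_near. Qed.

Lemma sampled_abs_continuous : abs_continuous 0 (N%:R * eps) psi.1 /\
  abs_continuous 0 (N%:R * eps) psi.2.
Proof.
have lip s t : 0 <= s -> s <= t -> t <= N%:R * eps ->
    `|sampled N t - sampled N s| <= (1 - eta) * (- y) * (t - s).
  by move=> s0 st tN; have /andP[i0 ?] := sampled_increment s0 st tN; rewrite ger0_norm.
split.
- apply: (@abs_continuous_lipschitz _ _ _ (`|c / c1| * ((1 - eta) * - y))) =>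
  s t s0 st tN.
  by rewrite /= -mulrBr normrM -mulrA ler_wpM2l// lip.
- apply: (@abs_continuous_lipschitz _ _ _ (`|- (c / c2)| * ((1 - eta) * - y))) =>
  s t s0 st tN.
  by rewrite /= -mulrBr normrM -mulrA ler_wpM2l// lip.
Qed.

Lemma sampled_cost_ge : terminating y x alpha psi /\
  ((value_fun x - (c * eta ^+ 2 * (- y) ^+ 2 * (N%:R * eps) + eps * clamped_cost x))%:E <=
    cost r c1 c2 y h x psi (alpha psi))%E.
Proof.
have [tau [/andP[tau0 tauN] tauE phi_tau]] := sampled_terminates.
split; first by split; [exact: sampled_path|rewrite tauE ltry].
rewrite /cost tauE /=; set rho := alpha psi.
have phi_ni s t : 0 <= s -> s <= t -> t <= tau -> phi t <= phi s.
  move=> s0 st tt; have := phi_increment s0 st (le_trans tt tauN).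
  have : 0 <= eta * (- y) * (t - s).
    by rewrite mulr_ge0 ?subr_ge0// mulr_ge0// ltW// neg_y_gt0.
  lra.
have phi_itv t : 0 <= t <= tau -> 0 <= phi t <= x.
  move=> /andP[t0 tt]; rewrite -{1}phi_tau phi_ni//= (le_trans (phi_ni 0 t _ _ _))//.
  by rewrite phi_initial lerBlDr lerDl control_ge0.
have /andP[x0 xb] := x_itv.
(* The state is nonincreasing up to [tau], so [H] is monotone and thereby measurable even if the
   control jumps. *)
pose H t := clamped_cost (phi (clamp 0 tau t)).
have HE t : 0 <= t <= tau -> H t = clamped_cost (phi t) by move=> ?; rewrite /H clamp_id.
have H_ni : {homo H : s t / s <= t >-> t <= s}.
  move=> s t st; apply: clamped_cost_ndecr.
  have /andP[? _] := clamp_itv s tau0; have /andP[_ ?] := clamp_itv t tau0.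
  by apply: phi_ni => //; exact: clamp_homo.
have H_itv t : 0 <= H t <= h beta by exact: clamped_cost_itv.
have iH s t : (@lebesgue_measure R).-integrable `[s, t] (EFin \o H).
  apply: (@bounded_integrable_itv _ _ _ (h beta)).
    exact: nonincreasing_measurable.
  by move=> u _; have /andP[? ?] := H_itv u; rewrite ger0_norm.
pose J t := \int[lebesgue_measure]_(u in `[0, t]) H u.
have J_inc s t : 0 <= s -> s <= t -> H t * (t - s) <= J t - J s.
  move=> s0 st; rewrite /J Rintegral_itvB ?bnd_simp// Rintegral_itv_obnd_cbnd; last first.
    by apply: integrableS (iH s t) => //; exact: subset_itv_oc_cc.
  have -> : H t * (t - s) = \int[lebesgue_measure]_(u in `[s, t]) cst (H t) u.
    rewrite Rintegral_cst//= lebesgue_measure_itv/= lte_fin.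
    case: ltP => //= ts; have -> : s = t by lra.
    by rewrite subrr.
  apply: le_Rintegral => //; first exact: integrable_cst_itv.
  by move=> u /=; rewrite in_itv/= => /andP[_ ut]; exact: H_ni.
pose e t := c1 * (derive1 psi.1 t) ^+ 2 + c2 * (derive1 psi.2 t) ^+ 2.
have e0 t : 0 <= e t by rewrite addr_ge0// mulr_ge0 ?sqr_ge0// ltW.
(* [B] is the energy spent up to [t]. The term in [eta ^+ 2] pays for slowing the feedback;
   [eps * (clamped_cost x - H t)] is the telescoped sampling error. *)
pose Q t B := value_fun x - value_fun (phi t) <= J t + r * rho t - B
  + c * eta ^+ 2 * (- y) ^+ 2 * t + eps * (clamped_cost x - H t).
have ind n : (n <= N)%N -> forall t, 0 <= t -> t <= n%:R * eps -> t <= tau ->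
    exists B, [/\ measurable_fun `[0, t] e,
      (\int[lebesgue_measure]_(u in `[0%R, t]) (e u)%:E = B%:E)%E & Q t B].
  elim: n => [_ t t0 tn tt|n IH nN t t0 tn tt].
    have -> : t = 0 by move: tn; rewrite mul0r; lra.
    exists 0; split.
    - by rewrite set_itv1; exact: measurable_fun_set1.
    - by rewrite set_itv1 integral_set1.
    rewrite /Q mulr0 addr0 subr0 /J set_itv1 Rintegral_set1 add0r HE ?lexx//.
    have px : phi 0 <= x by have /andP[] := phi_itv 0 (introT andP (conj (lexx 0) tau0)).
    have : 0 <= eps * (clamped_cost x - clamped_cost (phi 0)).
      by rewrite mulr_ge0 ?(ltW eps_gt0)// subr_ge0; exact: clamped_cost_ndecr.
    have := value_fun_lip px; rewrite phi_initial -/rho.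
    have -> : x - (x - rho 0) = rho 0 by ring.
    lra.
  have [tn'|nt] := leP t (n%:R * eps); first exact: IH (ltnW nN) t t0 tn' tt.
  set a := n%:R * eps in nt.
  have a0 : 0 <= a by rewrite mulr_ge0// ltW.
  have at_ := ltW nt; have atau := le_trans at_ tt.
  have [B [me eB QB]] := IH (ltnW nN) a a0 (lexx _) atau.
  have ek u : a < u < t -> e u = c * speed n ^+ 2.
    move=> /andP[au ut]; apply: (sampled_derive nN).
    by rewrite -/a au (lt_le_trans ut).
  have [me' eB'] := integral_append_constant a0 at_ e0 me eB ek.
  exists (B + c * speed n ^+ 2 * (t - a)); split => //.
  have tS : t - a <= eps by move: tn; rewrite -natr1 mulrDl mul1r -/a; lra.
  have ta0 : 0 <= t - a by rewrite subr_ge0.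
  have dphi : phi a - phi t = (- y) * (t - a) - speed n * (t - a) + (rho t - rho a).
    have := sampled_cell nN at_ tn; rewrite -/a => wt.
    have wE u : psi.1 u - psi.2 u = sampled N u by exact: effortB.
    have -> : phi a - phi t = - y * (t - a) - (psi.1 t - psi.2 t - (psi.1 a - psi.2 a))
        + (rho t - rho a) by rewrite /phi /dynamics -/rho; ring.
    by rewrite !wE wt; ring.
  have Ha := hamilton_jacobi (phi a).
  set f := optimal_rate (phi a) in Ha.
  have sf : speed n = (1 - eta) * f by [].
  have /andP[f0 fy] : 0 <= f <= - y by exact: optimal_rate_itv.
  have := value_fun_convex (phi a) (phi t); rewrite -/f dphi.
  have rho_le : rho a <= rho t by exact: control_increment.
  have fr : 2 * c * f * (rho t - rho a) <= r * (rho t - rho a).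
    by rewrite ler_wpM2r ?subr_ge0//; exact: marginal_value_le.
  have HaE : H a = clamped_cost (phi a) by rewrite HE// a0.
  have Jat := J_inc a t a0 at_.
  have Hat : (H a - H t) * (t - a) <= (H a - H t) * eps.
    by rewrite ler_wpM2l// subr_ge0; exact: H_ni.
  (* Slowing by [eta] costs only second order in [eta], because the rate is optimal. This is
     essential: the time needed to terminate is of order [1 / eta]. *)
  have key : 2 * c * f * (- y * (t - a) - speed n * (t - a)) <=
      (H a - c * speed n ^+ 2 + c * eta ^+ 2 * (- y) ^+ 2) * (t - a).
    have -> : 2 * c * f * (- y * (t - a) - speed n * (t - a)) =
      (H a - c * speed n ^+ 2 + c * eta ^+ 2 * f ^+ 2) * (t - a).
      by rewrite HaE Ha sf; ring.
    apply: ler_wpM2r => //; rewrite lerD2l; apply: ler_wpM2l.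
      by rewrite mulr_ge0 ?sqr_ge0 ?(ltW c0).
    by apply: lerXn2r => //; rewrite nnegrE// (le_trans f0).
  move: QB key Hat Jat fr; rewrite /Q; lra.
have [B [me eB QB]] := ind N (leqnn N) tau tau0 tauN (lexx _).
have [ac1 ac2] := sampled_abs_continuous.
have -> : path_cost c1 c2 tau psi = B%:E.
  by rewrite /path_cost asboolT//; split;
    [apply: abs_continuous_subitv ac1|apply: abs_continuous_subitv ac2].
have -> : (\int[lebesgue_measure]_(t in `[0%R,
  tau]) (h (dynamics y x psi rho t))%:E = (J tau)%:E)%E.
  transitivity (\int[lebesgue_measure]_(t in `[0%R, tau]) (H t)%:E)%E.
    apply: eq_integral => t; rewrite inE/= in_itv/= => tt; rewrite HE// clamped_cost_id//.
    by have /andP[-> /le_trans ->] := phi_itv t tt.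
  by rewrite /J /Rintegral fineK//; apply: integrable_fin_num.
have -> : ((J tau)%:E + (r * rho tau)%:E - B%:E = (J tau + r * rho tau - B)%:E)%E by [].
rewrite lee_fin.
have : c * eta ^+ 2 * (- y) ^+ 2 * tau <= c * eta ^+ 2 * (- y) ^+ 2 * (N%:R * eps).
  apply: ler_wpM2l => //; apply: mulr_ge0; last exact: sqr_ge0.
  by apply: mulr_ge0; [exact: ltW|exact: sqr_ge0].
have : 0 <= eps * H tau by rewrite mulr_ge0 ?(ltW eps_gt0)//; have /andP[] := H_itv tau.
move: QB; rewrite /Q phi_tau value_fun0; lra.
Qed.

End SampledFeedback.


Lemma value_ge (x : R) (alpha : strategy R) : 0 <= x <= beta -> admissible D y x alpha ->
  ((value_fun x)%:E <= ereal_sup [set cost r c1 c2 y h x psi (alpha psi)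
                                 | psi in terminating y x alpha])%E.
Proof.
move=> x_itv adm; have y0 := neg_y_gt0; have /andP[x0 xb] := x_itv.
apply/lee_subgt0Pr => k k0.
have a0 : 0 < 2 * c * (- y) * (x + 1) by rewrite !mulr_gt0//; lra.
(* With [T] below, the loss [c * eta ^+ 2 * (- y) ^+ 2 * T] equals [c * eta * (- y) * (x + 1)], at
   most [k / 2]; [x + 1] makes the drift overshoot [x] strictly. *)
pose eta := Num.min (1 / 2) (k / (2 * c * (- y) * (x + 1))).
have eta0 : 0 < eta by rewrite lt_min divr_gt0//= divr_gt0.
have eta1 : eta < 1 by rewrite gt_min; apply/orP; left; lra.
have etak : eta * (2 * c * (- y) * (x + 1)) <= k.
  by rewrite -ler_pdivlMr// ge_min lexx orbT.
pose T := (x + 1) / (eta * (- y)).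
have etay0 : 0 < eta * (- y) by rewrite mulr_gt0.
have T0 : 0 < T by rewrite divr_gt0//; lra.
have TE : eta * (- y) * T = x + 1 by rewrite mulrC divfK// gt_eqF.
have /andP[H0 _] := clamped_cost_itv x.
(* Chosen so that the sampling error [T / N * clamped_cost x] is at most the other [k / 2]; the
   successor keeps [N] positive. *)
pose N := (Num.bound (2 * T * clamped_cost x / k)).+1.
have N0 : 0 < N%:R :> R by rewrite ltr0n.
have Nk : T / N%:R * clamped_cost x <= k / 2.
  rewrite mulrAC ler_pdivrMr//.
  have : 2 * T * clamped_cost x / k <= N%:R.
    apply/ltW/(lt_trans (archi_boundP _)); last by rewrite ltr_nat.
    by rewrite divr_ge0 ?(ltW k0)// mulr_ge0// mulr_ge0// ltW.
  by rewrite ler_pdivrMr//; lra.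
have eps0 : 0 < T / N%:R by rewrite divr_gt0.
have NT : N%:R * (T / N%:R) = T by rewrite mulrC divfK// gt_eqF.
have horizon : x < eta * (- y) * (N%:R * (T / N%:R)) by rewrite NT TE ltrDl.
have [term le] := sampled_cost_ge eps0 eta0 eta1 x_itv adm horizon.
apply: le_trans (ereal_sup_ubound _);
  last by exists (effort (sampled x alpha eta (T / N%:R) N)).
apply: le_trans le; rewrite -EFinB lee_fin lerD2l lerN2 NT.
have -> : c * eta ^+ 2 * (- y) ^+ 2 * T = c * eta * (- y) * (eta * (- y) * T) by ring.
by rewrite TE; move: etak Nk; lra.
Qed.

Lemma value_eq (x : R) (alpha : strategy R) : 0 <= x <= beta ->
  barrier_strategy D y x beta alpha -> value D r c1 c2 y h x = (value_fun x)%:E.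
Proof.
move=> x_itv bar; apply/eqP; rewrite eq_le; apply/andP; split.
  have [_ _ adm _] := bar.
  apply: (@le_trans _ _ (ereal_sup [set cost r c1 c2 y h x psi (alpha psi)
                                 | psi in terminating y x alpha])).
    by apply: ereal_inf_lbound; exists alpha.
  by apply: ge_ereal_sup => _ [psi tpsi <-]; exact: barrier_cost_le.
by apply: le_ereal_inf_tmp => _ [alpha' adm <-]; exact: value_ge.
Qed.

Lemma hext_clamped_cost u : u <= beta -> hext h u = clamped_cost u.
Proof. by move=> ub; rewrite /hext /clamped_cost /clamp min_l. Qed.

(** * The explicit path *)

(** The reflected state lies below the free path, which is strictly below [x <= beta] after time
    [0]; so the barrier is never touched after time [0] and both paths coincide up to the hitting
    time. *)
Lemma barrier_idle (x T : R) (alpha : strategy R) (psi : path2 R) :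
  0 <= x <= beta -> barrier_strategy D y x beta alpha -> continuous_path2 psi -> 0 <= T ->
  x + y * T + psi.1 T - psi.2 T = 0 ->
  (forall t, 0 <= t < T -> 0 < x + y * t + psi.1 t - psi.2 t) ->
  (forall t, 0 < t <= T -> x + y * t + psi.1 t - psi.2 t < x) ->
  hitting_time y x psi (alpha psi) = T%:E /\ forall t, 0 <= t <= T -> alpha psi t = 0.
Proof.
move=> /andP[x0 xb] [_ _ [[ctrl _] state] bar] cpsi T0 wT w_gt0 w_lt.
have [rho0 rho_nd rho_rc] := ctrl _ cpsi.
(* If the game were still running at [T], admissibility would force a zero control there, the free
   path being at [0]; then [T] would be a hitting time. *)
have le_T : (hitting_time y x psi (alpha psi) <= T%:E)%E.
  rewrite leNgt; apply/negP => lt.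
  have := state psi cpsi T T0 (ltW lt); rewrite in_itv/= /dynamics wT => /andP[dT _].
  have rhoT : alpha psi T = 0 by have := rho0 T T0; lra.
  suff : (hitting_time y x psi (alpha psi) <= T%:E)%E by rewrite leNgt lt.
  by apply: ereal_inf_lbound; exists T => //; split => //;
    rewrite /dynamics wT rhoT subr0.
have fin : (hitting_time y x psi (alpha psi) < +oo)%E by exact: le_lt_trans le_T (ltry _).
have [tau [tau0 tauE dyn_tau]] := hitting_time_attained cpsi (ctrl _ cpsi) fin.
have tauT : tau <= T by rewrite -lee_fin -tauE.
have [[_ psi10] [_ psi20]] := cpsi.
have w0 : x + y * 0 + psi.1 0 - psi.2 0 = x by rewrite psi10 psi20 mulr0 !addr0 subr0.
have idle t : 0 <= t <= tau -> alpha psi t = 0.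
  move=> /andP[t0 tt]; have := bar psi (conj cpsi fin).
  case: eqP => [b0 a0|_ [phi [eta1 [eta2 [sk skE]]]]].
    have xz : x = 0 by lra.
    have t_eq : t = 0.
      apply/eqP; rewrite eq_le t0 andbT leNgt; apply/negP => tp.
      have T0' : 0 < T by rewrite (lt_le_trans tp)// (le_trans tt).
      by have := w_gt0 0; rewrite lexx T0' w0 xz ltxx => /(_ isT).
    by rewrite t_eq a0.
  have phiE u : 0 <= u -> u <= tau -> phi u = x + y * u + psi.1 u - psi.2 u - alpha psi u.
    by move=> u0 ut; have [|<- _ _] := skE u u0 _; first by rewrite tauE lee_fin.
  have etaE u : 0 <= u -> u <= tau -> alpha psi u = eta2 u.
    by move=> u0 ut; have [|_ _ ->] := skE u u0 _; first by rewrite tauE lee_fin.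
  have [_ _ phi_itv _ _] := sk.
  have eta20 : eta2 0 = 0.
    have := phi_itv 0 (lexx 0); rewrite in_itv/= => /andP[_].
    (* Starting on the barrier: [phi 0 = beta] and [x <= beta] leave no room for a positive initial
       push. *)
    rewrite le_eqVlt => /predU1P[p0|]; last exact: (skorohod_initial sk).
    have := rho0 0 (lexx 0); rewrite (etaE 0)// => e0.
    by move: p0; rewrite phiE// w0 etaE//; lra.
  rewrite etaE// -eta20; apply: (skorohod_flat sk) => // u /andP[u0 ut].
  rewrite phiE ?(ltW u0) ?(le_trans ut)//.
  have := rho0 u (ltW u0); have := w_lt u;
    rewrite u0 (le_trans ut (le_trans tt tauT)) => /(_ isT).
  lra.
have tau_eq : tau = T.
  apply/eqP; rewrite eq_le tauT leNgt; apply/negP => lt.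
  have := w_gt0 tau; rewrite tau0 lt => /(_ isT).
  by move: dyn_tau; rewrite /dynamics idle ?tau0 ?lexx// subr0 => ->; rewrite ltxx.
by rewrite tauE tau_eq; split => //; move: idle; rewrite tau_eq.
Qed.

Section OptimalPath.
Variables (x m T : R) (w : R -> R).
Hypothesis x_itv : 0 <= x <= beta.
Hypothesis m_itv : 0 <= m <= T.
Let z0 := x + y * m.
Hypothesis z0_ge0 : 0 <= z0.
Hypothesis z0_gt : 0 < y ^+ 2 - clamped_cost z0 / c.
Hypothesis T_eq : T = m + oriented_integral
  (fun xi => (Num.sqrt (y ^+ 2 - hext h xi / c))^-1) z0.
Hypothesis w_cont : continuous w.
Hypothesis w_0 : forall t, 0 <= t <= m -> w t = 0.
Let z t := x + y * t + w t.
Hypothesis w_derive : forall t, m < t < T ->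
  is_derive t 1 w (optimal_rate (Num.min (z t) z0)).

(** The speed of descent of [z]; the cap at [z0], where the discriminant is positive, bounds it away
    from [0] on the whole line. *)
Let slope u := Num.sqrt (y ^+ 2 - clamped_cost (Num.min u z0) / c).
(* Separation of variables: [time_to (z t) + t] is constant along the path. *)
Let time_to u := oriented_integral (fun v => (slope v)^-1) u.

Let z_cont : continuous z.
Proof.
move=> t; apply: cvgD; last exact: w_cont.
apply: cvgD; first exact: cvg_cst.
by apply: cvgM; [exact: cvg_cst|exact: cvg_id].
Qed.

Let z0_le : z0 <= beta.
Proof.
have /andP[_ xb] := x_itv; have /andP[m0 _] := m_itv; have := neg_y_gt0 => y0.
have : 0 <= (- y) * m by rewrite mulr_ge0// ltW.
by rewrite /z0; lra.
Qed.

Let slope_gt0 u : 0 < slope u.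
Proof.
rewrite sqrtr_gt0; apply: lt_le_trans z0_gt _.
rewrite lerD2l lerN2; apply: ler_wpM2r; first by rewrite invr_ge0 ltW.
by apply: clamped_cost_ndecr; rewrite ge_min lexx orbT.
Qed.

Let slope_cont : continuous (fun v => (slope v)^-1).
Proof.
move=> u; apply: cvgV; first by rewrite gt_eqF// slope_gt0.
apply: (@continuous_comp _ _ _ (fun v =>
  y ^+ 2 - clamped_cost (Num.min v z0) / c) Num.sqrt);
  last exact: sqrt_continuous.
apply: cvgB; first exact: cvg_cst.
apply: cvgM; last exact: cvg_cst.
apply: (@continuous_comp _ _ _ (fun v => Num.min v z0) clamped_cost);
  last exact: clamped_cost_continuous.
by apply: (@continuous_min _ _ id (cst z0)); [exact: cvg_id|exact: cvg_cst].
Qed.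

Let time_to_derive (u : R) : is_derive u 1 time_to (slope u)^-1.
Proof. exact: oriented_integral_derive. Qed.

Let time_to_lt u v : (time_to u < time_to v) = (u < v).
Proof.
have lt p q : p < q -> time_to p < time_to q.
  move=> pq; rewrite -subr_gt0; have [s _ ->] := mean_value time_to_derive (ltW pq).
  by rewrite mulr_gt0 ?invr_gt0 ?subr_gt0.
have [uv|vu|->] := ltgtP u v;
  [exact: lt|by rewrite ltNge (ltW (lt _ _ vu))|by rewrite ltxx].
Qed.

Let time_to0 : time_to 0 = 0.
Proof. by rewrite /time_to /oriented_integral lexx set_itv1 Rintegral_set1. Qed.

Let time_to_z0 : T = m + time_to z0.
Proof.
rewrite T_eq /time_to /oriented_integral z0_ge0; congr (_ + _).
apply: eq_Rintegral => u; rewrite inE/= in_itv/= => /andP[u0 uz].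
by rewrite /slope min_l// hext_clamped_cost// (le_trans uz).
Qed.

Let slopeE u : u <= z0 -> y + optimal_rate u = - slope u.
Proof. by move=> uz; rewrite /slope min_l// /optimal_rate; ring. Qed.

Let z_m : z m = z0.
Proof. by rewrite /z w_0 ?addr0// lexx andbT; have /andP[] := m_itv. Qed.

Let z_derive (t : R) : m < t < T -> is_derive t 1 z (- slope (z t)).
Proof.
move=> mt; have dw := w_derive mt.
have -> : - slope (z t) = 0 + (y * 1 + 1 * 0) + optimal_rate (Num.min (z t) z0).
  rewrite mulr1 mulr0 addr0 add0r [RHS]slopeE ?ge_min ?lexx ?orbT//.
  by rewrite /slope -minA minxx.
apply: is_deriveD; apply: is_derive_eq; rewrite /GRing.scale/=; ring.
Qed.

Lemma optimal_path_time t : m <= t <= T -> time_to (z t) = T - t.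
Proof.
move=> mt; have Kc : continuous (fun t => time_to (z t) + t).
  move=> s; apply: cvgD; last exact: cvg_id.
  apply: (@continuous_comp _ _ _ z time_to); first exact: z_cont.
  exact: (is_derive_continuous time_to_derive).
have := constant_of_zero_derive Kc _ mt; rewrite z_m => K.
suff : time_to (z t) + t = time_to z0 + m by rewrite time_to_z0; lra.
apply: K => s ms; have dz := z_derive ms; have dt := time_to_derive (z s).
have -> : 0 = (slope (z s))^-1 * (- slope (z s)) + 1 :> R.
  by rewrite mulrN mulVf ?addNr// gt_eqF// slope_gt0.
by apply: is_deriveD; exact: (@is_derive1_comp _ time_to z).
Qed.

Lemma optimal_path_end : z T = 0.
Proof.
have /andP[m0 mT] := m_itv; have zT := optimal_path_time (introT andP (conj mT (lexx T))).
by apply/eqP; rewrite eq_le !leNgt -(time_to_lt 0) -(time_to_lt (z T) 0) zT time_to0 subrr ltxx.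
Qed.

(** The cap at [z0] in the differential equation thus turns out to be inactive: the remaining time
    [T - t] is at most [time_to z0]. *)
Lemma optimal_path_le t : m <= t <= T -> z t <= z0.
Proof.
move=> mt; rewrite leNgt -time_to_lt optimal_path_time// -leNgt time_to_z0.
by have /andP[? _] := mt; lra.
Qed.

Lemma optimal_path_early t : 0 <= t <= m -> z t = x + y * t.
Proof. by move=> tm; rewrite /z w_0// addr0. Qed.

Lemma optimal_path_gt0 t : 0 <= t < T -> 0 < z t.
Proof.
have y0 := neg_y_gt0; move=> /andP[t0 tT]; have [mt|tm] := leP m t.
  by rewrite -time_to_lt time_to0 optimal_path_time ?mt ?(ltW tT)// subr_gt0.
rewrite optimal_path_early ?t0 ?(ltW tm)//; apply: le_lt_trans z0_ge0 _.
have : 0 < (- y) * (m - t) by rewrite mulr_gt0// subr_gt0.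
by rewrite /z0; lra.
Qed.

Lemma optimal_path_lt t : 0 < t <= T -> z t < x.
Proof.
have y0 := neg_y_gt0; move=> /andP[t0 tT]; have [tm|mt] := leP t m.
  rewrite optimal_path_early ?(ltW t0)//.
  have : 0 < (- y) * t by rewrite mulr_gt0.
  lra.
have zt : z t < z0.
  by rewrite -time_to_lt optimal_path_time ?tT ?(ltW mt)// time_to_z0; lra.
apply: lt_le_trans zt _; have /andP[m0 _] := m_itv.
have : 0 <= (- y) * m by rewrite mulr_ge0// ltW.
by rewrite /z0; lra.
Qed.

Let w_lip s t : 0 <= s -> s <= t -> t <= T -> `|w t - w s| <= (- y) * (t - s).
Proof.
have y0 := neg_y_gt0; have /andP[m0 mT] := m_itv.
have late p q : m <= p -> p <= q -> q <= T -> `|w q - w p| <= (- y) * (q - p).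
  move=> mp pq qT.
  have [u|u _ ->] := MVT_segment pq (df := fun u => optimal_rate (Num.min (z u) z0)) _
      (continuous_subspaceT w_cont).
    rewrite in_itv/= => /andP[pu uq]; apply: w_derive.
    by rewrite (le_lt_trans mp)// (lt_le_trans uq).
  have /andP[f0 fy] := optimal_rate_itv (Num.min (z u) z0).
  have qp0 : 0 <= q - p by rewrite subr_ge0.
  by rewrite ger0_norm ?mulr_ge0//; exact: ler_wpM2r.
move=> s0 st tT; have [ms|sm] := leP m s; first exact: late.
have [tm|mt] := leP t m.
  rewrite !w_0 ?subrr ?normr0 ?mulr_ge0 ?subr_ge0 ?(ltW y0)//.
    by rewrite s0 ltW.
  by rewrite (le_trans s0).
rewrite (w_0 (t := s)) ?s0 ?(ltW sm)// -(w_0 (t := m)) ?m0 ?lexx//.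
apply: le_trans (late m t (lexx m) (ltW mt) tT) _.
by rewrite ler_wpM2l ?(ltW y0)//; lra.
Qed.

(** [A] is the running cost on [[0, m]], where no energy is spent. Afterwards running cost minus
    energy plus [value_fun (z t)] is constant, the feedback being the equality case of the
    verification. *)
Lemma optimal_path_cost (psi : path2 R) :
  (forall t, 0 <= t <= T -> psi.1 t = (effort w).1 t /\ psi.2 t = (effort w).2 t) ->
  exists A, 0 <= A <= h beta * m /\
  ((\int[lebesgue_measure]_(t in `[0%R, T]) (h (z t))%:E - path_cost c1 c2 T psi)%E
    = (A + value_fun z0)%:E).
Proof.
move=> psiE; have y0 := neg_y_gt0; have /andP[m0 mT] := m_itv.
have T0 : 0 <= T := le_trans m0 mT; have /andP[x0 xb] := x_itv.
pose H t := clamped_cost (z t); pose f t := optimal_rate (z t).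
pose k t := c * f t ^+ 2.
have cH : continuous H.
  by move=> t; apply: (@continuous_comp _ _ _ z clamped_cost);
    [exact: z_cont|exact: clamped_cost_continuous].
have ck : continuous k.
  have cf : continuous f.
    by move=> t; apply: (@continuous_comp _ _ _ z optimal_rate);
      [exact: z_cont|exact: optimal_rate_continuous].
  by move=> t; apply: cvgM; [exact: cvg_cst|apply: cvgM; exact: cf].
pose J := oriented_integral H; pose E := oriented_integral k.
have dJ (t : R) : is_derive t 1 J (H t) by exact: oriented_integral_derive.
have dE (t : R) : is_derive t 1 E (k t) by exact: oriented_integral_derive.
have J0 : J 0 = 0 by rewrite /J /oriented_integral lexx set_itv1 Rintegral_set1.
have z_itv t : 0 <= t <= T -> 0 <= z t <= beta.
  move=> /andP[t0 tT]; apply/andP; split.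
    move: tT; rewrite le_eqVlt => /predU1P[->|tT]; first by rewrite optimal_path_end.
    by rewrite ltW// optimal_path_gt0// t0.
  apply: le_trans xb; move: t0; rewrite le_eqVlt => /predU1P[<-|t0].
    by rewrite optimal_path_early ?lexx// mulr0 addr0.
  by rewrite ltW// optimal_path_lt// t0.
have hz : (\int[lebesgue_measure]_(t in `[0%R, T]) (h (z t))%:E = (J T)%:E)%E.
  have -> : J T = \int[lebesgue_measure]_(t in `[0, T]) H t.
    by rewrite -oriented_integralB// -/J J0 subr0.
  rewrite /Rintegral fineK.
    by apply: eq_integral => t; rewrite inE/= in_itv/= => tT;
      rewrite /H clamped_cost_id// z_itv.
  by apply: integrable_fin_num => //; exact: integrable_continuous_itv.
have ac : abs_continuous 0 T psi.1 /\ abs_continuous 0 T psi.2.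
  split.
  - apply: (@abs_continuous_lipschitz _ _ _ (`|c / c1| * - y)) => s t s0 st tT.
    rewrite !(psiE _ _).1 ?s0 ?(le_trans s0 st) ?(le_trans st tT)//=.
    by rewrite -mulrBr normrM -mulrA ler_wpM2l// w_lip.
  - apply: (@abs_continuous_lipschitz _ _ _ (`|- (c / c2)| * - y)) => s t s0 st tT.
    rewrite !(psiE _ _).2 ?s0 ?(le_trans s0 st) ?(le_trans st tT)//=.
    by rewrite -mulrBr normrM -mulrA ler_wpM2l// w_lip.
pose e t := c1 * (derive1 psi.1 t) ^+ 2 + c2 * (derive1 psi.2 t) ^+ 2.
have e0 t : 0 <= e t by rewrite addr_ge0// mulr_ge0 ?sqr_ge0// ltW.
have near_psi t : 0 < t < T ->
    \forall s \near t, psi.1 s = (effort w).1 s /\ psi.2 s = (effort w).2 s.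
  move=> /andP[t0 tT]; near=> s; apply: psiE; apply/andP; split; apply/ltW.
    by near: s; exact: lt_nbhsr.
  by near: s; exact: lt_nbhsl.
have e_early t : 0 < t < m -> e t = 0.
  move=> /andP[t0 tm]; have t0T : 0 < t < T by rewrite t0 (lt_le_trans tm).
  have dw : is_derive t 1 w 0.
    apply: (@near_eq_is_derive R R R (cst 0)); near=> s; rewrite /cst w_0//.
    apply/andP; split; apply/ltW.
      by near: s; exact: lt_nbhsr.
    by near: s; exact: lt_nbhsl.
  by rewrite /e (effort_energy (near_psi t t0T) dw) expr0n mulr0.
have e_late t : m < t < T -> e t = k t.
  move=> /[dup] mt /andP[m_t tT].
  have t0T : 0 < t < T by rewrite (le_lt_trans m0).
  have := w_derive mt; rewrite min_l; last by apply: optimal_path_le; rewrite !ltW.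
  by move=> dw; rewrite /e (effort_energy (near_psi t t0T) dw).
have me0 : measurable_fun `[(0 : R), 0] e by rewrite set_itv1; exact: measurable_fun_set1.
have ie0 : (\int[lebesgue_measure]_(u in `[0%R, 0%R]) (e u)%:E = 0%:E)%E.
  by rewrite set_itv1 integral_set1.
have [mem iem] := integral_append_constant (lexx 0) m0 e0 me0 ie0 e_early.
rewrite mul0r addr0 in iem.
have [_ ieT] := integral_append_continuous m0 mT e0 mem iem ck e_late.
rewrite add0r -oriented_integralB// -/E in ieT.
have -> : path_cost c1 c2 T psi = (E T - E m)%:E by rewrite /path_cost asboolT.
exists (J m); split.
  have [u _] := mean_value dJ m0; rewrite J0 !subr0 => ->.
  have /andP[H0 Hb] := clamped_cost_itv (z u).
  by rewrite mulr_ge0//= ler_wpM2r.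
rewrite hz -EFinB; congr EFin.
have cK : continuous (fun t => J t - E t + value_fun (z t)).
  move=> t; apply: cvgD.
    by apply: cvgB; [exact: (is_derive_continuous dJ)|exact: (is_derive_continuous dE)].
  apply: (@continuous_comp _ _ _ z value_fun); first exact: z_cont.
  exact: (is_derive_continuous value_fun_derive).
have := constant_of_zero_derive cK _ (introT andP (conj mT (lexx T))).
rewrite optimal_path_end value_fun0 z_m => K.
suff : J T - E T + 0 = J m - E m + value_fun z0 by lra.
apply: K => t mt; have /andP[m_t tT] := mt.
have dz := z_derive mt; have dv := value_fun_derive (z t).
have zt : z t <= z0 by apply: optimal_path_le; rewrite !ltW.
have -> : 0 = (H t - k t) + 2 * c * optimal_rate (z t) * (- slope (z t)) :> R.
  by rewrite -slopeE// /H hamilton_jacobi /k /f; ring.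
by apply: is_deriveD.
Unshelve. all: by end_near. Qed.

Lemma optimal_path_game (alpha : strategy R) (psi : path2 R) :
  barrier_strategy D y x beta alpha -> continuous_path2 psi ->
  (forall t, 0 <= t <= T -> psi.1 t = (effort w).1 t /\ psi.2 t = (effort w).2 t) ->
  hitting_time y x psi (alpha psi) = T%:E /\
  exists A, 0 <= A <= h beta * m /\
    cost r c1 c2 y h x psi (alpha psi) = (A + value_fun z0)%:E.
Proof.
move=> bar cpsi psiE; have /andP[m0 mT] := m_itv.
have T0 : 0 <= T := le_trans m0 mT.
have zE t : 0 <= t <= T -> x + y * t + psi.1 t - psi.2 t = z t.
  by move=> /psiE[-> ->]; rewrite -addrA effortB.
have z_T : x + y * T + psi.1 T - psi.2 T = 0 by rewrite zE ?T0 ?lexx// optimal_path_end.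
have z_gt0 t : 0 <= t < T -> 0 < x + y * t + psi.1 t - psi.2 t.
  by move=> /andP[t0 tT]; rewrite zE ?t0 ?ltW// optimal_path_gt0// t0.
have z_lt t : 0 < t <= T -> x + y * t + psi.1 t - psi.2 t < x.
  by move=> /andP[t0 tT]; rewrite zE ?tT ?ltW// optimal_path_lt// t0.
have [hit idle] := barrier_idle x_itv bar cpsi T0 z_T z_gt0 z_lt.
split => //; have [A [AI AE]] := optimal_path_cost psiE.
exists A; split => //; rewrite -AE /cost hit/= idle ?T0 ?lexx// mulr0 adde0.
congr (_ - _)%E; apply: eq_integral => t; rewrite inE/= in_itv/= => tT.
by rewrite /dynamics zE// idle// subr0.
Qed.

End OptimalPath.

(** [m] is the time actually spent drifting: [delta] in general, but the whole duration when
    [x + y * delta < 0], since the drift alone then reaches [0] before time [delta]. *)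
Lemma claimed_path_game (x delta : R) (alpha : strategy R) (psi : path2 R) :
  0 <= x <= beta -> barrier_strategy D y x beta alpha -> 0 <= delta ->
  (0 <= x + y * delta -> 0 < y ^+ 2 - h (x + y * delta) / c) ->
  claimed_path c1 c2 y h x delta psi ->
  hitting_time y x psi (alpha psi) = (tau_tilde c1 c2 y h x delta)%:E /\
  exists m A, [/\ 0 <= m <= delta, 0 <= x + y * m, 0 <= A <= h beta * m &
    cost r c1 c2 y h x psi (alpha psi) = (A + value_fun (x + y * m))%:E].
Proof.
move=> x_itv bar delta0 disc [cpsi [omega [[com om0 om_early [dom [_ domE]]] psiE]]].
have y0 := neg_y_gt0; have /andP[x0 xb] := x_itv.
set T := tau_tilde _ _ _ _ _ _ in com om_early domE psiE *.
have yd : 0 <= (- y) * delta by rewrite mulr_ge0// ltW.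
have inv_ge0 u : 0 <= (Num.sqrt (y ^+ 2 - hext h u / c))^-1 by rewrite invr_ge0 sqrtr_ge0.
have game m : 0 <= m <= T -> m <= delta -> 0 <= x + y * m ->
    0 < y ^+ 2 - clamped_cost (x + y * m) / c ->
    T = m + oriented_integral (fun xi =>
      (Num.sqrt (y ^+ 2 - hext h xi / c))^-1) (x + y * m) ->
    (m < T -> m = delta) ->
  hitting_time y x psi (alpha psi) = T%:E /\
  exists m A, [/\ 0 <= m <= delta, 0 <= x + y * m, 0 <= A <= h beta * m &
    cost r c1 c2 y h x psi (alpha psi) = (A + value_fun (x + y * m))%:E].
  move=> /[dup] m_itv /andP[m0 mT] md zm_ge0 zm_disc TE m_lt.
  have T0 : 0 <= T by exact: le_trans mT.
  pose w := omega \o clamp 0 T.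
  have wE t : 0 <= t <= T -> w t = omega t by move=> tT; rewrite /w /= clamp_id.
  have cw : continuous w by exact: continuous_comp_clamp.
  have w_early t : 0 <= t <= m -> w t = 0.
    move=> /andP[t0 tm]; rewrite wE ?t0 ?(le_trans tm)//.
    by apply: om_early; rewrite ?in_itv/= ?t0 ?(le_trans tm).
  have w_late t : m < t < T ->
      is_derive t 1 w (optimal_rate (Num.min (x + y * t + w t) (x + y * m))).
    move=> /andP[mt tT]; have mdelta := m_lt (lt_trans mt tT).
    have t0T : 0 <= t <= T by rewrite (le_trans m0 (ltW mt)) ltW.
    have It : [set` `[delta, T]] t by rewrite /= in_itv/= -mdelta !ltW.
    have [dwithin dE] := domE t It.
    apply: (@near_eq_is_derive R R R omega).
      near=> s; rewrite wE//; apply/andP; split; apply/ltW.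
        by near: s; apply: lt_nbhsr; rewrite (le_lt_trans m0).
      by near: s; exact: lt_nbhsl.
    have := @is_derive_within _ _ _ delta T t _ _ _ dwithin.
    rewrite dE -mdelta -wE// /optimal_rate -hext_clamped_cost; first apply.
    - by rewrite mt.
    - by move=> s /andP[ms sT]; rewrite /= in_itv/= !ltW.
    - rewrite ge_min; apply/orP; right; have : 0 <= (- y) * m by rewrite mulr_ge0// ltW.
      lra.
  have psi_w t : 0 <= t <= T -> psi.1 t = (effort w).1 t /\ psi.2 t = (effort w).2 t.
    by move=> tT; rewrite /= wE//; apply: psiE; rewrite in_itv.
  have [-> [A [AI AE]]] := optimal_path_game x_itv m_itv zm_ge0 zm_disc TE cw w_early w_late
    bar cpsi psi_w.
  by split => //; exists m, A; rewrite m0.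
have [z_ge0|z_lt0] := leP 0 (x + y * delta).
  apply: (game delta) => //.
    rewrite delta0/= /T /tau_tilde lerDl /oriented_integral z_ge0.
    exact: Rintegral_ge0.
  by rewrite clamped_cost_id ?disc// z_ge0; lra.
(* On the negative half-line [hext] is [0], so the integrand is the constant [(- y)^-1] and the
   oriented integral subtracts the excess of [delta] over [x / (- y)]. *)
have TE : T = x / (- y).
  rewrite /T /tau_tilde /oriented_integral leNgt z_lt0/=.
  rewrite (@eq_Rintegral _ _ _ _ _ (cst (- y)^-1)); last first.
    move=> u; rewrite inE/= in_itv/= => /andP[_ u0].
    rewrite /hext max_l// h_0 mul0r subr0 sqrtr_sqr -normrN ger0_norm// ltW//.
  rewrite Rintegral_cst//= lebesgue_measure_itv/= lte_fin z_lt0/=.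
  by field; lra.
have yT : x + y * T = 0 by rewrite TE; field; lra.
apply: (game T) => //; rewrite ?yT ?ltxx//.
- by rewrite lexx TE divr_ge0// ltW.
- by rewrite TE ler_pdivrMr//; lra.
- by rewrite clamped_cost_le0// mul0r subr0 -sqrrN exprn_gt0.
- by rewrite /oriented_integral lexx set_itv1 Rintegral_set1 addr0.
Unshelve. all: by end_near. Qed.

End ValueFunction.

(** * Exact and approximate optimality of the explicit path *)

Theorem theorem3p5 (R : realType) (D r c1 c2 y : R) (h : R -> R)
    (D_gt0 : 0 < D) (r_gt0 : 0 < r) (c1_gt0 : 0 < c1) (c2_gt0 : 0 < c2)
    (h_cont : {within `[0, D], continuous h})
    (h_incr : {in `[0, D] &, {homo h : u v / u < v}})
    (h_0 : h 0 = 0)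
    (y_le : r / (4 * ceff c1 c2) <= - y)
    (h_lip : [lipschitz h u | u in `[0, D]])
    (x : R) (x_in : x \in `[0, beta0 D r c1 c2 y h])
    (alpha : strategy R)
    (alpha_barrier :
      barrier_strategy D y x (beta0 D r c1 c2 y h) alpha) :
  let c := ceff c1 c2 in
  let beta := beta0 D r c1 c2 y h in
  [/\ 0 < y ^+ 2 - h beta / c \/ x < beta ->
      forall psi, claimed_path c1 c2 y h x 0 psi ->
        cost r c1 c2 y h x psi (alpha psi) = value D r c1 c2 y h x,
      y ^+ 2 - h beta / c = 0 /\ x = beta ->
      exists C : R, 0 < C /\
        forall delta, 0 < delta <= x ->
        forall psi, claimed_path c1 c2 y h x delta psi ->
          (`|cost r c1 c2 y h x psi (alpha psi) - value D r c1 c2 y h x|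
             <= (C * delta)%:E)%E
    & forall delta,
        (0 < y ^+ 2 - h beta / c \/ x < beta -> delta = 0) ->
        (y ^+ 2 - h beta / c = 0 /\ x = beta -> 0 < delta <= x) ->
        forall psi, claimed_path c1 c2 y h x delta psi ->
          hitting_time y x psi (alpha psi) = (tau_tilde c1 c2 y h x delta)%:E].
Proof.
move=> c beta.
have c0 : 0 < c by exact: ceff_gt0.
have y0 : 0 < - y by exact: neg_y_gt0 y_le.
have x_itv : 0 <= x <= beta by move: x_in; rewrite in_itv.
have /andP[x0 xb] := x_itv.
have [/andP[b0 bD] hb] : 0 <= beta <= D /\ h beta <= r * (- y) - r ^+ 2 / (4 * c).
  exact: beta_spec.
have hb0 : 0 <= h beta by rewrite -h_0; exact: (h_ndecr h_incr).
have disc_ge0 : 0 <= y ^+ 2 - h beta / c.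
  have := discriminant_ge0 D_gt0 r_gt0 c1_gt0 c2_gt0 h_cont h_incr h_0 y_le beta.
  by rewrite clamped_cost_id// b0 lexx.
have disc_lt u : 0 <= u -> u < beta -> 0 < y ^+ 2 - h u / c.
  move=> u0 ub; apply: le_lt_trans disc_ge0 _.
  have hu : h u < h beta.
    by apply: h_incr => //; rewrite in_itv/= ?b0 ?u0//= (le_trans (ltW ub)).
  have ci : 0 < c^-1 by rewrite invr_gt0; exact: c0.
  have huc : h u / c < h beta / c by rewrite (ltr_pM2r ci); exact: hu.
  by lra.
have game := claimed_path_game D_gt0 r_gt0 c1_gt0 c2_gt0 h_cont h_incr h_0 y_le x_itv alpha_barrier.
have valE := value_eq D_gt0 r_gt0 c1_gt0 c2_gt0 h_cont h_incr h_0 y_le x_itv alpha_barrier.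
have disc_regular : 0 < y ^+ 2 - h beta / c \/ x < beta ->
    0 <= x + y * 0 -> 0 < y ^+ 2 - h (x + y * 0) / c.
  rewrite mulr0 addr0 => -[disc _|xlt _]; last exact: disc_lt.
  move: xb; rewrite le_eqVlt => /predU1P[->//|]; exact: disc_lt.
(* Drifting for a positive time moves the state strictly below [beta], where [h] is smaller and the
   discriminant is positive. *)
have disc_degenerate delta : x = beta -> 0 < delta -> 0 <= x + y * delta ->
    0 < y ^+ 2 - h (x + y * delta) / c.
  move=> xE d0 z0; apply: disc_lt => //; have : 0 < (- y) * delta by rewrite mulr_gt0.
  by rewrite -xE; lra.
split.
- move=> reg psi cl.
  have [_ [m [A [/andP[m0 m0'] _ AI ->]]]] := game 0 psi (lexx 0) (disc_regular reg) cl.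
  have mE : m = 0 by lra.
  rewrite valE; congr EFin; move: AI; rewrite mE !mulr0 addr0 => /andP[? ?].
  have -> : A = 0 by lra.
  by rewrite add0r.
(* While drifting for [m <= delta], the running cost is at most [h beta * m], and the value drops by
   at most [r] times the displacement [(- y) * m]. *)
- move=> [_ xE]; exists (h beta + r * (- y)).
  have ry : 0 < r * - y by rewrite mulr_gt0.
  split => [|delta /andP[d0 _] psi cl]; first by lra.
  have [_ [m [A [/andP[m0 md] zm /andP[A0 Am] ->]]]] :=
    game delta psi (ltW d0) (disc_degenerate delta xE d0) cl.
  rewrite valE -EFinB lee_fin.
  have ym : 0 <= (- y) * m by rewrite mulr_ge0// ltW.
  have zx : x + y * m <= x by lra.
  have := value_fun_lip D_gt0 r_gt0 c1_gt0 c2_gt0 h_cont h_incr h_0 y_le zx.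
  have := value_fun_ndecr D_gt0 r_gt0 c1_gt0 c2_gt0 h_cont h_incr h_0 y_le zx.
  set v1 := value_fun _ _ _ _ _ _ _; set v2 := value_fun _ _ _ _ _ _ _ => v12 vlip.
  have h1 : h beta * m <= h beta * delta by rewrite ler_wpM2l.
  have h2 : r * (- y) * m <= r * (- y) * delta by rewrite ler_wpM2l// ltW.
  have h3 : 0 <= h beta * delta by rewrite mulr_ge0// ltW.
  have h4 : 0 <= r * (- y) * m by rewrite mulr_ge0// ltW.
  by rewrite ler_norml; apply/andP; split; lra.
- move=> delta d_reg d_deg psi cl.
  have [reg|/not_orP[nd nx]] := pselect (0 < y ^+ 2 - h beta / c \/ x < beta).
    move: cl; rewrite (d_reg reg) => cl.
    by have [] := game 0 psi (lexx 0) (disc_regular reg) cl.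
  have deg : y ^+ 2 - h beta / c = 0 /\ x = beta.
    by split; apply/eqP; rewrite eq_le ?disc_ge0 ?xb ?andbT/= leNgt; apply/negP.
  have /andP[d0 _] := d_deg deg.
  by have [] := game delta psi (ltW d0) (disc_degenerate delta deg.2 d0) cl.
Qed.
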